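(* Let $X$ be an infinite-dimensional complex Banach space, $T\in L(X)$, $T^*$ its dual, and $\Delta_e(T)=\sigma(T)\setminus\sigma_e(T)$. The following are equivalent: (i) $T\in(B_e)$; (ii) for every $\lambda\in\Delta_e(T)$, $p:=p(T-\lambda I)$ is finite and $H_0((T\oplus T^* )-\lambda I)=\mathcal N(((T\oplus T^* )-\lambda I)^p)$; (iii) $H_0((T\oplus T^* )-\lambda I)$ is finite-dimensional for every $\lambda\in\Delta_e(T)$; (iv) $H_0((T\oplus T^* )-\lambda I)$ is closed for every $\lambda\in\Delta_e(T)$; (v) $K((T\oplus T^* )-\lambda I)$ has finite codimension in $X\oplus X^*$ for every $\lambda\in\Delta_e(T)$.
   Context: $T\oplus T^*$ acts on $X\oplus X^*$. For an operator $S$ on a Banach space $Y$: the quasinilpotent part is $H_0(S)=\{x\in Y:\lim_{n\to\infty}\|S^nx\|^{1/n}=0\}$; the analytic core $K(S)$ is the set of $x\in Y$ for which there exist $c>0$ and a sequence $(x_n)$ in $Y$ with $x_0=x$, $Sx_{n+1}=x_n$ and $\|x_n\|\le c^n\|x\|$ for all $n$. $\alpha(S)=\dim\mathcal N(S)$, $\beta(S)=\operatorname{codim}\mathcal R(S)$, ascent $p(S)=\inf\{n:\mathcal N(S^n)=\mathcal N(S^{n+1})\}$, descent $q(S)=\inf\{n:\mathcal R(S^n)=\mathcal R(S^{n+1})\}$. $S$ Fredholm: $\mathcal R(S)$ closed, $\alpha,\beta<\infty$. $\sigma_e(T)$: set of $\lambda$ with $T-\lambda I$ not Fredholm. $\Pi^0(T)$: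 $\lambda\in\sigma(T)$ with $p(T-\lambda I),q(T-\lambda I)<\infty$ and $\alpha(T-\lambda I)<\infty$. $T\in(B_e)$ means $\Delta_e(T)=\Pi^0(T)$. *)

(* Defs.v *)
From mathcomp Require Import all_boot all_order all_algebra.
From mathcomp Require Import all_classical all_reals all_analysis.
From mathcomp Require Import complex.
Import Order.TTheory GRing.Theory Num.Theory.
Import numFieldTopology.Exports numFieldNormedType.Exports.

Set Implicit Arguments.
Unset Strict Implicit.
Unset Printing Implicit Defensive.

Local Open Scope classical_set_scope.
Local Open Scope ring_scope.

Section BanachDefs.
Variable R : realType.
Local Notation C := R[i].
Variable X : normedModType C.

(* real-valued norm on X (the norm of a normedModType C is a real element of C) *)
Definition nrm (x : X) : R := complex.Re `|x|.

Definition lin_op (A : X -> X) : Prop :=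
  forall (a : C) (x y : X), A (a *: x + y) = a *: A x + A y.
Definition lin_fun (f : X -> C) : Prop :=
  forall (a : C) (x y : X), f (a *: x + y) = a * f x + f y.

Definition dualsp : set (X -> C) := [set f | lin_fun f /\ continuous (f : X -> C^o)].

Definition dnorm (f : X -> C) : R :=
  sup [set complex.Re `|f x| | x in [set x : X | nrm x <= 1]].

Definition lincombX (cs : seq C) (s : seq X) : X :=
  \sum_(p <- zip cs s) p.1 *: p.2.
Definition spanX (s : seq X) : set X :=
  [set x | exists cs : seq C, size cs = size s /\ x = lincombX cs s].
Definition findimX (A : set X) : Prop := exists s : seq X, A = spanX s.

Definition kerX (A : X -> X) : set X := [set x | A x = 0].
Definition rngX (A : X -> X) : set X := range A.

Definition alpha_fin (A : X -> X) : Prop := findimX (kerX A).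
Definition beta_fin (A : X -> X) : Prop :=
  exists s : seq X, forall x : X, exists z : X, exists2 y, spanX s y & x = A z + y.

Definition fredholm (A : X -> X) : Prop :=
  closed (rngX A) /\ alpha_fin A /\ beta_fin A.

Definition invertible_op (A : X -> X) : Prop :=
  exists B : X -> X, continuous B /\ cancel A B /\ cancel B A.

Definition shiftop (T : X -> X) (l : C) : X -> X := fun x => T x - l *: x.

Definition spectrum (T : X -> X) : set C :=
  [set l | ~ invertible_op (shiftop T l)].
Definition ess_spectrum (T : X -> X) : set C :=
  [set l | ~ fredholm (shiftop T l)].
Definition Delta_e (T : X -> X) : set C := spectrum T `\` ess_spectrum T.

Definition is_ascent (A : X -> X) (p : nat) : Prop :=
  kerX (iter p A) = kerX (iter p.+1 A) /\
  forall n, (n < p)%N -> kerX (iter n A) <> kerX (iter n.+1 A).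
Definition ascent_fin (A : X -> X) : Prop :=
  exists n, kerX (iter n A) = kerX (iter n.+1 A).
Definition descent_fin (A : X -> X) : Prop :=
  exists n, rngX (iter n A) = rngX (iter n.+1 A).

Definition Pi0 (T : X -> X) : set C :=
  [set l | spectrum T l /\ ascent_fin (shiftop T l) /\ descent_fin (shiftop T l)
           /\ alpha_fin (shiftop T l)].

Definition Be (T : X -> X) : Prop := Delta_e T = Pi0 T.

Definition Y : set (X * (X -> C)) := [set y | dualsp y.2].
Definition Ynorm (y : X * (X -> C)) : R := nrm y.1 + dnorm y.2.
Definition Y0 : X * (X -> C) := (0, fun _ => 0).
Definition Yadd (y z : X * (X -> C)) : X * (X -> C) :=
  (y.1 + z.1, fun u => y.2 u + z.2 u).
Definition Ysub (y z : X * (X -> C)) : X * (X -> C) :=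
  (y.1 - z.1, fun u => y.2 u - z.2 u).
Definition Yscale (a : C) (y : X * (X -> C)) : X * (X -> C) :=
  (a *: y.1, fun u => a * y.2 u).
Definition lincombY (cs : seq C) (s : seq (X * (X -> C))) : X * (X -> C) :=
  foldr (fun p acc => Yadd (Yscale p.1 p.2) acc) Y0 (zip cs s).
Definition spanY (s : seq (X * (X -> C))) : set (X * (X -> C)) :=
  [set y | exists cs : seq C, size cs = size s /\ y = lincombY cs s].

(* (T oplus Tdual) - lambda I acting on X oplus Xdual, with Tdual f = f o T *)
Definition sumop (T : X -> X) (l : C) (y : X * (X -> C)) : X * (X -> C) :=
  (T y.1 - l *: y.1, fun u => y.2 (T u) - l * y.2 u).

Definition H0 (S : X * (X -> C) -> X * (X -> C)) : set (X * (X -> C)) :=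
  [set y | Y y /\ (fun n : nat => powR (Ynorm (iter n S y)) (n%:R^-1)) @ \oo --> (0 : R)].

Definition Kcore (S : X * (X -> C) -> X * (X -> C)) : set (X * (X -> C)) :=
  [set y | Y y /\ exists c : R, 0 < c /\
     exists u : nat -> X * (X -> C), (forall n, Y (u n)) /\ u 0%N = y /\
       (forall n, S (u n.+1) = u n) /\ (forall n, Ynorm (u n) <= c ^+ n * Ynorm y)].

Definition kerY (S : X * (X -> C) -> X * (X -> C)) : set (X * (X -> C)) :=
  [set y | Y y /\ S y = Y0].

Definition findimY (A : set (X * (X -> C))) : Prop :=
  exists s : seq (X * (X -> C)), (forall y, y \in s -> Y y) /\ A = spanY s.

(* closedness in the norm of X oplus Xdual (a normed, hence metric, space):
   sequential closedness *)
Definition closedY (A : set (X * (X -> C))) : Prop :=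
  forall (u : nat -> X * (X -> C)) (y : X * (X -> C)),
    (forall n, A (u n)) -> Y y ->
    (fun n => Ynorm (Ysub (u n) y)) @ \oo --> (0 : R) -> A y.

Definition fincodimY (A : set (X * (X -> C))) : Prop :=
  exists s : seq (X * (X -> C)), (forall y, y \in s -> Y y) /\
    forall y, Y y -> exists2 k, A k & exists2 z, spanY s z & y = Yadd k z.

End BanachDefs.

(* Main.v *)
(** Put [A = T - l] with [l] in [Delta_e T]; then every power of [A] has finite-dimensional
    kernel and, by an open mapping argument, closed range of finite codimension.  If [A]
    has finite ascent and descent, then both equal some [p] and [A] has a bounded Drazin
    inverse [J]; applying [J] and its adjoint on [X (+) X*] gives [H0 = N(S^p)], where
    [S = A (+) A*], and shows that [K(S)] contains the range of the projection [S J], whose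
    kernel [N(S^p)] is finite-dimensional.

    Conversely, the chains [N(S^n)] (inside [H0]) and [R(S^n)] (containing [K(S)]) stabilise
    when [H0] has finite dimension, respectively [K(S)] finite codimension, and Hahn-Banach
    transfers this to the kernels and ranges of [A].  If [H0] is closed but the ascent or the
    descent is infinite, there is a geometrically bounded chain [S u_(n+1) = u_n], [S u_0 = 0],
    [u_0 <> 0]; the series [sum mu^n u_n] is then an eigenvector of [S] for small [mu <> 0]
    and belongs to [H0], which is absurd. *)

Require Import Defs.
From mathcomp Require Import all_boot all_order all_algebra.
From mathcomp Require Import all_classical all_reals all_analysis.
From mathcomp Require Import complex.
From mathcomp Require Import ring lra zify.
Import Order.TTheory GRing.Theory Num.Theory.
Import numFieldTopology.Exports numFieldNormedType.Exports.

Set Implicit Arguments.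
Unset Strict Implicit.
Unset Printing Implicit Defensive.

Local Open Scope classical_set_scope.
Local Open Scope ring_scope.

(** * Subspaces and finite spans *)

(** Fredholmness provides a closed range for [A], but the argument also needs R(A^n), of which only
    finite codimension is clear. Not knowing R(A^n) to be a Banach space shapes the open mapping
    argument: missing vectors are adjoined until Baire's method applies to all of X, and the
    conclusion is brought back one vector at a time. This yields closedness and preimages of
    controlled norm at once, and these preimages are the source of the geometric bounds. When the
    ascent is infinite, finite dimension of N(A) lets them be chosen inside the intersection of all
    R(A^n); when the ascent is finite and the descent is not, the chain consists of functionals
    obtained by Hahn-Banach extension. *)

Definition subsp (K : fieldType) (V : lmodType K) (W : set V) : Prop :=
  W 0 /\ forall a x y, W x -> W y -> W (a *: x + y).

Definition lin (K : fieldType) (V W : lmodType K) (f : V -> W) : Prop :=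
  forall a x y, f (a *: x + y) = a *: f x + f y.

(** Peeling off one generator at a time allows induction on the list, so that the arguments on
    finite dimension need neither bases nor a dimension count. *)
Fixpoint lspan (K : fieldType) (V : lmodType K) (s : seq V) : set V :=
  if s is v :: s' then [set x | exists a : K, lspan s' (x - a *: v)]
  else [set 0].

Section Subspaces.
Variables (K : fieldType) (V : lmodType K).
Implicit Types (W : set V) (s t : seq V).

Lemma subsp0 W : subsp W -> W 0. Proof. by case. Qed.

Lemma subspD W x y : subsp W -> W x -> W y -> W (x + y).
Proof. by case=> _ + Wx Wy => /(_ 1 x y Wx Wy); rewrite scale1r. Qed.

Lemma subspZ W a x : subsp W -> W x -> W (a *: x).
Proof. by move=> [W0 Wl] Wx; rewrite -[a *: x]addr0; apply: Wl. Qed.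

Lemma subspB W x y : subsp W -> W x -> W y -> W (x - y).
Proof.
by move=> sW Wx Wy; apply: subspD => //; rewrite -scaleN1r; apply: subspZ.
Qed.

Lemma subspI W1 W2 : subsp W1 -> subsp W2 -> subsp (W1 `&` W2).
Proof.
move=> [W10 W1l] [W20 W2l]; split=> // a x y [? ?] [? ?].
by split; [apply: W1l | apply: W2l].
Qed.

Lemma lspan_subsp s : subsp (lspan s).
Proof.
elim: s => [|v s IHs] /=; first by split=> // a x y -> ->; rewrite scaler0 addr0.
split; first by exists 0; rewrite scale0r subr0; apply: subsp0.
move=> a x y [b xb] [c yc]; exists (a * b + c).
have -> : a *: x + y - (a * b + c) *: v = a *: (x - b *: v) + (y - c *: v).
  by rewrite scalerBr scalerA scalerDl opprD addrACA.
by case: IHs => _; apply.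
Qed.

Lemma lspan_sub W s : subsp W -> (forall v, v \in s -> W v) -> lspan s `<=` W.
Proof.
move=> sW; elim: s => [_ x ->|v s IHs sub x [a xa]]; first exact: subsp0.
rewrite -(subrK (a *: v) x); apply: subspD => //.
  by apply: IHs xa => w ws; apply: sub; rewrite inE ws orbT.
by apply: subspZ => //; apply: sub; rewrite inE eqxx.
Qed.

Lemma lspan_cat s t x y : lspan s x -> lspan t y -> lspan (s ++ t) (x + y).
Proof.
elim: s x => [x -> //|v s IHs x [a xa] ty]; first by rewrite add0r.
by exists a; rewrite addrAC; apply: IHs.
Qed.

Lemma sub_lspan W t : subsp W -> W `<=` lspan t ->
  exists s, (forall v, v \in s -> W v) /\ W = lspan s.
Proof.
move=> sW; elim: t W sW => [|v t IHt] W sW sub.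
  exists [::]; split=> //; apply/seteqP; split=> [x /sub //|x ->]; exact: subsp0.
have [s [sWs Ws]] := IHt _ (subspI sW (lspan_subsp t)) (fun x => @proj2 _ _).
have [[w Ww [a a0 wa]]|no] :=
    pselect (exists2 w, W w & exists2 a, a != 0 & lspan t (w - a *: v)).
  exists (w :: s); split=> [u|]; first by rewrite inE => /orP[/eqP-> //|/sWs[]].
  apply/seteqP; split=> [x Wx|x [b xb]].
    have [c xc] := sub _ Wx; exists (c / a); rewrite -Ws; split.
      by apply: subspB => //; apply: subspZ.
    have -> : x - (c / a) *: w = - (c / a) *: (w - a *: v) + (x - c *: v).
      rewrite scalerBr scalerA mulNr divfK // !scaleNr opprK.
      by rewrite -addrA [c *: v + _]addrC subrK addrC.
    by case: (lspan_subsp t) => _; apply.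
  rewrite -(subrK (b *: w) x); apply: subspD => //; last exact: subspZ.
  by have : lspan s (x - b *: w) := xb; rewrite -Ws => -[].
exists s; split=> [u /sWs[] //|]; rewrite -Ws; apply/seteqP; split=> [x Wx|x []//].
split=> //; have [a xa] := sub _ Wx; have [a0|a0] := eqVneq a 0.
  by move: xa; rewrite a0 scale0r subr0.
by exfalso; apply: no; exists x => //; exists a.
Qed.

Definition monotone_chain (W : nat -> set V) : Prop :=
  (forall m n, (m <= n)%N -> W m `<=` W n) \/
  (forall m n, (m <= n)%N -> W n `<=` W m).

Lemma chain_lspan_stable (W : nat -> set V) t : monotone_chain W ->
  (forall n, subsp (W n)) -> (forall n, W n `<=` lspan t) ->
  exists m, forall n, (m <= n)%N -> W n = W m.
Proof.
elim: t W => [|v t IHt] W mW sW sub.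
  exists 0%N => n _; apply/seteqP; split=> x /sub ->; exact: subsp0.
have mI : monotone_chain (fun n => W n `&` lspan t).
  by case: mW => mW; [left|right] => m n mn x [Wx tx]; split=> //; apply: (mW _ _ mn).
have [m1 stab1] := IHt _ mI (fun n => subspI (sW n) (lspan_subsp t))
   (fun n x => @proj2 _ _).
pose Q n := exists2 w, W n w & lspan t (w - v).
have [m2 stab2] : exists m, forall n, (m <= n)%N -> Q n <-> Q m.
  case: mW => mW.
    have [[m Qm]|noQ] := pselect (exists m, Q m).
      exists m => n mn; split=> // _; case: Qm => w Ww tw.
      by exists w => //; apply: (mW _ _ mn).
    by exists 0%N => n _; split=> Qn; exfalso; apply: noQ; [exists n|exists 0%N].
  have [[m Qm]|noQ] := pselect (exists m, ~ Q m).
    exists m => n mn; split=> // -[w Ww tw]; exfalso; apply: Qm.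
    by exists w => //; apply: (mW _ _ mn).
  have aQ n : Q n by apply: contrapT => Qn; apply: noQ; exists n.
  by exists 0%N.
have key i j : W i `<=` W j -> W i `&` lspan t = W j `&` lspan t ->
    (Q j -> Q i) -> W j `<=` W i.
  move=> ij eqI Qji x Wx; have [a xa] := sub _ _ Wx.
  have [a0|a0] := eqVneq a 0.
    have : (W j `&` lspan t) x by split=> //; move: xa; rewrite a0 scale0r subr0.
    by rewrite -eqI => -[].
  have /Qji [w Ww tw] : Q j.
    exists (a^-1 *: x); first exact: subspZ.
    rewrite -[v]scale1r -(mulVf a0) -scalerA -scalerBr.
    exact: subspZ (lspan_subsp t) xa.
  rewrite -(subrK (a *: w) x); apply: subspD => //; last exact: subspZ.
  suff : (W j `&` lspan t) (x - a *: w) by rewrite -eqI => -[].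
  split; first by apply: subspB => //; apply: subspZ => //; apply: ij.
  have -> : x - a *: w = (x - a *: v) - a *: (w - v).
    by rewrite scalerBr opprB addrA subrK.
  by apply: subspB (lspan_subsp t) _ _ => //; apply: subspZ (lspan_subsp t) tw.
exists (maxn m1 m2) => n; rewrite geq_max => /andP[m1n m2n].
have eqI : W n `&` lspan t = W (maxn m1 m2) `&` lspan t.
  by rewrite (stab1 _ m1n) (stab1 _ (leq_maxl _ _)).
have eqQ : Q n <-> Q (maxn m1 m2).
  by rewrite (stab2 _ m2n) (stab2 _ (leq_maxr m1 m2)).
have mn : (maxn m1 m2 <= n)%N by rewrite geq_max m1n.
case: mW => /(_ _ _ mn) mW; apply/seteqP; split=> //; apply: key => //.
- by case: eqQ.
- by case: eqQ.
Qed.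

(** Each [W n] is [B] plus its part inside [lspan s], which reduces the claim to a chain in a finite
    span. *)
Lemma cofinite_chain_stable (W : nat -> set V) (B : set V) (Z : set V) s :
  (forall m n, (m <= n)%N -> W n `<=` W m) ->
  (forall n, subsp (W n)) -> (forall n, B `<=` W n) -> (forall n, W n `<=` Z) ->
  (forall x, Z x -> exists2 b, B b & lspan s (x - b)) ->
  exists m, forall n, (m <= n)%N -> W n = W m.
Proof.
move=> mW sW BW WZ Zs.
have [||m stab] := @chain_lspan_stable (fun n => W n `&` lspan s) s _
    (fun n => subspI (sW n) (lspan_subsp s)); last 1 first.
- exists m => n mn; apply/seteqP; split=> [x Wx|x Wx]; first exact: mW Wx.
  have [b Bb xb] := Zs _ (WZ _ _ Wx).
  have : (W n `&` lspan s) (x - b).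
    by rewrite (stab _ mn); split=> //; apply: subspB => //; apply: BW.
  by case=> Wn _; rewrite -(subrK b x); apply: subspD => //; apply: BW.
- by right=> m n mn x [Wx sx]; split=> //; apply: mW Wx.
- by move=> n x [].
Qed.

Lemma subsp_functional_split W (f : V -> K) : subsp W ->
  (forall a x y, f (a *: x + y) = a * f x + f y) ->
  exists2 w, W w & forall x, W x -> exists a, W (x - a *: w) /\ f (x - a *: w) = 0.
Proof.
move=> sW fl; have fB x a w : f (x - a *: w) = f x - a * f w.
  by rewrite addrC -scaleNr fl mulNr addrC.
have [[w Ww fw]|no] := pselect (exists2 w, W w & f w != 0).
  exists w => // x Wx; exists (f x / f w); rewrite fB divfK // subrr; split=> //.
  by apply: subspB => //; apply: subspZ.
exists 0; [exact: subsp0 | move=> x Wx; exists 0]; rewrite scale0r subr0; split=> //.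
by apply/eqP; apply: contrapT => /negP fx; apply: no; exists x.
Qed.

(** Each functional cuts off at most one dimension, and nothing is left on the common kernel. It
    serves to bound the space of functionals vanishing on a range of finite codimension. *)
Lemma functionals_findim W (I : eqType) (r : seq I) (f : I -> V -> K) : subsp W ->
  (forall i a x y, f i (a *: x + y) = a * f i x + f i y) ->
  (forall x, W x -> (forall i, i \in r -> f i x = 0) -> x = 0) ->
  exists t, W `<=` lspan t.
Proof.
elim: r W => [|i r IHr] W sW fl inj.
  by exists [::] => x Wx; apply: inj.
have [w Ww dec] := subsp_functional_split sW (fl i).
have sk : subsp [set x | f i x = 0].
  split=> [|a x y /= fx fy]; last by rewrite fl fx fy mulr0 addr0.
  by have /= := fl i (-1) 0 0; rewrite scaler0 addr0 mulN1r addNr.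
have [||t sub] := IHr _ (subspI sW sk) _.
- by [].
- move=> x [Wx fx] fr; apply: inj => // j; rewrite inE => /orP[/eqP-> //|/fr//].
by exists (w :: t) => x Wx; have [a [Wa fa]] := dec _ Wx; exists a; apply: sub.
Qed.

End Subspaces.

Section LinearMaps.
Variables (K : fieldType) (U V : lmodType K) (f : U -> V).
Hypothesis fl : lin f.

Lemma lin0 : f 0 = 0.
Proof. by have := fl (-1) 0 0; rewrite scaler0 addr0 scaleN1r addNr. Qed.

Lemma linZ a x : f (a *: x) = a *: f x.
Proof. by have := fl a x 0; rewrite lin0 !addr0. Qed.

Lemma linD x y : f (x + y) = f x + f y.
Proof. by have := fl 1 x y; rewrite !scale1r. Qed.

Lemma linB x y : f (x - y) = f x - f y.
Proof. by rewrite -scaleN1r linD linZ scaleN1r. Qed.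

Lemma lspan_map s x : lspan s x -> lspan (map f s) (f x).
Proof.
elim: s x => [x ->|v s IHs x [a xa]] /=; first exact: lin0.
by exists a; rewrite -linZ -linB; apply: IHs.
Qed.

Lemma lspan_lift (W : set U) t : (forall v, v \in t -> (f @` W) v) ->
  exists s, forall y, lspan t y -> exists2 x, lspan s x & f x = y.
Proof.
elim: t => [_|v t IHt sub].
  by exists [::] => y ->; exists 0 => //; exact: lin0.
have [w _ wv] := sub v (mem_head _ _).
have [u ut|s lift] := IHt; first by apply: sub; rewrite inE ut orbT.
exists (w :: s) => y [a /lift [x sx fx]]; exists (x + a *: w).
  by exists a; rewrite addrK.
by rewrite linD linZ fx wv subrK.
Qed.

(** Generators of the image are lifted; what a lift misses lies in the kernel. *)
Lemma preim_findim (W : set U) t k : subsp W ->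
  (forall x, W x -> lspan t (f x)) -> (forall x, f x = 0 -> lspan k x) ->
  exists s, W `<=` lspan s.
Proof.
move=> sW sub ker; have simg : subsp (f @` W).
  split; first by exists 0; [exact: subsp0 | exact: lin0].
  by move=> a _ _ [x Wx <-] [y Wy <-]; exists (a *: x + y) => //; apply: sW.2.
have [t' [t'W eqt']] : exists s, (forall v, v \in s -> (f @` W) v) /\ f @` W = lspan s.
  by apply: (sub_lspan (t := t)) => // _ [x Wx <-]; apply: sub.
have [s lift] := lspan_lift t'W; exists (k ++ s) => x Wx.
have [|z sz fz] := lift (f x); first by rewrite -eqt'; exists x.
rewrite -(subrK z x); apply: lspan_cat => //; apply: ker.
by rewrite linB fz subrr.
Qed.

End LinearMaps.

Lemma lin_iter (K : fieldType) (V : lmodType K) (f : V -> V) n :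
  lin f -> lin (iter n f).
Proof. by move=> fl; elim: n => // n IHn a x y; rewrite !iterS IHn fl. Qed.

(** * The Hahn-Banach theorem for complex vector spaces *)

Section Modulus.
Variable R : realType.
Implicit Types z w : R[i].

(** The norm of [R[i]] takes values in [R[i]]; a real modulus allows suprema and order arguments in
    [R]. *)
Definition cabs z : R := complex.Re `|z|.

Lemma normcabs z : `|z| = (cabs z)%:C%C.
Proof. by rewrite /cabs RRe_real // normr_real. Qed.

Lemma cabs_ge0 z : 0 <= cabs z.
Proof. by rewrite -ler0c -normcabs. Qed.

Lemma cabsM z w : cabs (z * w) = cabs z * cabs w.
Proof. by apply: complexI; rewrite -normcabs normrM !normcabs rmorphM. Qed.

Lemma cabsD z w : cabs (z + w) <= cabs z + cabs w.
Proof. by rewrite -lecR -normcabs rmorphD /= -!normcabs ler_normD. Qed.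

Lemma cabsN z : cabs (- z) = cabs z.
Proof. by rewrite /cabs normrN. Qed.

Lemma cabsC (r : R) : cabs r%:C%C = `|r|.
Proof. by rewrite /cabs normc_def /= expr0n /= addr0 sqrtr_sqr. Qed.

Lemma cabs0 : cabs 0 = 0.
Proof. by rewrite (cabsC 0) normr0. Qed.

Lemma cabs1 : cabs 1 = 1.
Proof. by rewrite (cabsC 1) normr1. Qed.

Lemma cabs_eq0 z : cabs z = 0 -> z = 0.
Proof. by move=> z0; apply/eqP; rewrite -normr_eq0 normcabs z0. Qed.

Lemma cabsX z n : cabs (z ^+ n) = cabs z ^+ n.
Proof. by elim: n => [|n IHn]; rewrite ?cabs1 // !exprS cabsM IHn. Qed.

Lemma cabs_i : cabs 'i%C = 1.
Proof. by rewrite /cabs normc_def /= expr0n /= add0r expr1n sqrtr1. Qed.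

Lemma Re_le_cabs z : `|complex.Re z| <= cabs z.
Proof. by rewrite -lecR -normcabs normc_ge_Re. Qed.

Lemma Im_le_cabs z : `|complex.Im z| <= cabs z.
Proof.
have := Re_le_cabs (z * 'i%C).
by rewrite ReiNIm normrN cabsM cabs_i mulr1.
Qed.

Lemma cabs_le z : cabs z <= `|complex.Re z| + `|complex.Im z|.
Proof.
rewrite {1}(complexE z); apply: le_trans (cabsD _ _) _.
by rewrite cabsM cabs_i mul1r !cabsC.
Qed.

Lemma unimodular_cabs z : exists2 w, cabs w = 1 & w * z = (cabs z)%:C%C.
Proof.
have [->|z0] := eqVneq z 0; first by exists 1; rewrite ?cabs1 ?mulr0 ?cabs0.
have a0 : cabs z != 0 by apply: contraNneq z0 => /cabs_eq0 ->.
exists ((cabs z)%:C%C / z); last by rewrite divfK.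
have : cabs ((cabs z)%:C%C / z) * cabs z = cabs z.
  by rewrite -cabsM divfK // cabsC ger0_norm // cabs_ge0.
by move=> /(canRL (mulfK a0)) ->; rewrite divff.
Qed.

End Modulus.

Section HahnBanachReal.
Variables (R : realType) (V : lmodType R[i]) (p : V -> R).
Hypothesis pD : forall x y, p (x + y) <= p x + p y.
Hypothesis pZ : forall a x, p (a *: x) = cabs a * p x.

(** Partial functionals are graphs, so that Zorn's lemma works with inclusion. Single-valuedness
    follows from domination: the element (0, s - t) gives s - t <= p 0 = 0. *)
Let linear_graph (G : set (V * R)) : Prop :=
  forall (r : R) x s y t, G (x, s) -> G (y, t) -> G (r%:C%C *: x + y, r * s + t).
Let dominated (G : set (V * R)) : Prop := forall x t, G (x, t) -> t <= p x.

Let pZpos (r : R) x : 0 < r -> p (r%:C%C *: x) = r * p x.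
Proof. by move=> r0; rewrite pZ cabsC gtr0_norm. Qed.

Let graph_extend (G : set (V * R)) v : G (0, 0) -> linear_graph G ->
  dominated G -> exists a : R,
  dominated [set q | exists r, G (q.1 - r%:C%C *: v, q.2 - r * a)].
Proof.
move=> G0 Gl Gd.
have GZ r x s : G (x, s) -> G (r%:C%C *: x, r * s).
  by move=> Gx; have := Gl r _ _ _ _ Gx G0; rewrite !addr0.
have bnd x s y t : G (x, s) -> G (y, t) -> s - p (x - v) <= p (y + v) - t.
  move=> Gx Gy; rewrite lerBlDr addrAC lerBrDr.
  have := Gl 1 _ _ _ _ Gx Gy; rewrite mul1r scale1r => /Gd /le_trans; apply.
  have -> : x + y = (y + v) + (x - v) by rewrite addrACA subrr addr0 addrC.
  exact: pD.
(* The value at [v] has to lie between every [s - p (x - v)] and every [p (y + v) - t]; the supremum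
   of the former does. *)
pose E := [set q | exists2 z : V * R, G z & q = z.2 - p (z.1 - v)].
have E0 : E !=set0 by exists (0 - p (0 - v)); exists (0, 0).
have hE y t : G (y, t) -> ubound E (p (y + v) - t).
  by move=> Gy _ [[x s] Gx ->]; apply: bnd.
have supE : has_sup E by split=> //; exists (p (0 + v) - 0); apply: hE.
exists (sup E) => x t [r /= Gx].
have [r0|r0|r0] := ltrgtP r 0; last first.
- by move: Gx; rewrite r0 scale0r mul0r !subr0 => /Gd.
- have := GZ r^-1 _ _ Gx => /hE hu; have := ge_sup E0 hu.
  rewrite lerBrDr mulrBr mulrA mulVf ?gt_eqF // mul1r addrC subrK.
  rewrite scalerBr scalerA -rmorphM /= mulVf ?gt_eqF // scale1r subrK.
  by rewrite pZpos ?invr_gt0 // ler_pM2l ?invr_gt0.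
- have nr0 : 0 < - r by rewrite oppr_gt0.
  have := GZ (- r)^-1 _ _ Gx => Gy.
  have : E ((- r)^-1 * (t - r * sup E) -
     p ((- r)^-1%:C%C *: (x - r%:C%C *: v) - v)) by eexists; [exact: Gy|].
  move/(ub_le_sup (proj2 supE)).
  have -> : (- r)^-1%:C%C *: (x - r%:C%C *: v) - v = (- r)^-1%:C%C *: x.
    rewrite scalerBr scalerA -rmorphM /= invrN mulNr mulVf ?lt_eqF //.
    by rewrite rmorphN1 scaleN1r opprK addrK.
  rewrite pZpos ?invr_gt0 // lerBlDr mulrBr mulrA invrN !mulNr mulVf ?lt_eqF //.
  rewrite mul1r opprK [sup E - _]addrC lerD2r lerN2.
  by rewrite ler_nM2l ?invr_lt0 //; rewrite -invrN.
Qed.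

(* Zorn's lemma is applied to the sets [G] such that [G0 `|` G] is admissible, so
   that the empty chain needs no separate upper bound. *)
Lemma hahn_banach_real (G0 : set (V * R)) : G0 (0, 0) ->
  linear_graph G0 -> dominated G0 ->
  exists f : V -> R, [/\ forall r x y, f (r%:C%C *: x + y) = r * f x + f y,
    forall x, f x <= p x & forall x t, G0 (x, t) -> f x = t].
Proof.
move=> G00 G0l G0d.
pose P (G : set (V * R)) := linear_graph (G0 `|` G) /\ dominated (G0 `|` G).
have [F FP Ftot|G [[Gl Gd] Gmax]] := @Zorn_bigcup _ P.
  split=> [r x s y t|x t]; last first.
    by case=> [/G0d //|[G FG Gx]]; apply: (FP _ FG).2; right.
  case=> [Gx|[G1 FG1 Gx]] [Gy|[G2 FG2 Gy]].
  - by left; apply: G0l.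
  - have [] := (FP _ FG2).1 r x s y t (or_introl Gx) (or_intror Gy); first by left.
    by right; exists G2.
  - have [] := (FP _ FG1).1 r x s y t (or_intror Gx) (or_introl Gy); first by left.
    by right; exists G1.
  - have [G12|G21] := Ftot _ _ FG1 FG2.
    + have [] := (FP _ FG2).1 r x s y t (or_intror (G12 _ Gx)) (or_intror Gy).
        by left.
      by right; exists G2.
    + have [] := (FP _ FG1).1 r x s y t (or_intror Gx) (or_intror (G21 _ Gy)).
        by left.
      by right; exists G1.
pose H := G0 `|` G; have H0 : H (0, 0) by left.
have tot v : exists t, H (v, t).
  apply: contrapT => nov.
  have [a Ha] := graph_extend v H0 Gl Gd.
  pose G' := [set q : V * R | exists r, H (q.1 - r%:C%C *: v, q.2 - r * a)].
  have HG' : H `<=` G'.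
    by move=> [x t] Hx; exists 0; rewrite scale0r mul0r !subr0.
  have G'v : G' (v, a) by exists 1; rewrite scale1r mul1r !subrr.
  have eqG' : G0 `|` G' = G'.
    by apply/seteqP; split=> [q [G0q|//]|q]; [apply: HG'; left|right].
  apply: (Gmax G').
    split=> [q Gq|sub]; first by apply: HG'; right.
    by apply: nov; exists a; right; apply: sub.
  split; rewrite eqG' // => r x s y t [b Hx] [c Hy]; exists (r * b + c) => /=.
  have := Gl r _ _ _ _ Hx Hy; congr (H (_, _)).
    by rewrite rmorphD rmorphM /= scalerDl scalerBr scalerA opprD addrACA.
  by rewrite /=; ring.
have [f Hf] := choice tot.
have uniq x s t : H (x, s) -> H (x, t) -> s = t.
  move=> Hs Ht; apply/eqP; rewrite eq_le.
  have p0 : p 0 = 0 by rewrite -(scale0r 0) pZ cabs0 mul0r.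
  have := Gl (-1) _ _ _ _ Hs Ht => /Gd.
  have := Gl (-1) _ _ _ _ Ht Hs => /Gd.
  rewrite !rmorphN1 !scaleN1r addNr p0 !mulN1r ![- _ + _]addrC !subr_le0.
  by move=> -> ->.
exists f; split=> [r x y|x|x t G0x].
- by apply: uniq (Hf _) _; apply: Gl; apply: Hf.
- exact: Gd (Hf x).
- by apply: uniq (Hf _) _; left.
Qed.

End HahnBanachReal.

Lemma hahn_banach (R : realType) (V : lmodType R[i]) (p : V -> R) (Z : set V)
    (g : V -> R[i]) :
  (forall x y, p (x + y) <= p x + p y) ->
  (forall a x, p (a *: x) = cabs a * p x) -> subsp Z ->
  (forall a x y, Z x -> Z y -> g (a *: x + y) = a * g x + g y) ->
  (forall x, Z x -> cabs (g x) <= p x) ->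
  exists f : V -> R[i],
    [/\ forall a x y, f (a *: x + y) = a * f x + f y,
      forall x, Z x -> f x = g x & forall x, cabs (f x) <= p x].
Proof.
move=> pD pZ sZ gl gp.
have g0 : g 0 = 0.
  by have := gl (-1) 0 0 sZ.1 sZ.1; rewrite scaler0 addr0 mulN1r addNr.
have gZ a x : Z x -> g (a *: x) = a * g x.
  by move=> Zx; have := gl a x 0 Zx sZ.1; rewrite g0 !addr0.
pose G0 := [set q : V * R | Z q.1 /\ q.2 = complex.Re (g q.1)].
have [||| F [Fl Fp FG]] := @hahn_banach_real _ _ p pD pZ G0.
- by split; [exact: sZ.1 | rewrite g0].
- move=> r x s y t [/= Zx ->] [/= Zy ->]; split; first exact: sZ.2.
  rewrite /= gl //; case: (g x) => a b; case: (g y) => c d /=.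
  by rewrite mul0r subr0.
- move=> x t [/= Zx ->]; apply: le_trans (gp _ Zx).
  exact: le_trans (ler_norm _) (Re_le_cabs _).
have F0 : F 0 = 0 by rewrite (FG 0 0) //; split=> /=; [exact: sZ.1 | rewrite g0].
have FD x y : F (x + y) = F x + F y by have := Fl 1 x y; rewrite scale1r mul1r.
have FZ r x : F (r%:C%C *: x) = r * F x by have := Fl r x 0; rewrite F0 !addr0.
have FN x : F (- x) = - F x.
  by have := FZ (-1) x; rewrite rmorphN1 scaleN1r mulN1r.
(* A complex functional is recovered from its real part by f x = F x - i F (i x), and [F] extends
   the real part of [g]. *)
pose f x : R[i] := (F x -i* F ('i%C *: x))%C.
have fD x y : f (x + y) = f x + f y.
  by rewrite /f scalerDr !FD opprD.
have fZ a x : f (a *: x) = a * f x.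
  case: a => a b; rewrite /f.
  have -> : (a +i* b)%C = a%:C%C + b%:C%C * 'i%C by simpc.
  have -> : 'i%C *: ((a%:C%C + b%:C%C * 'i%C) *: x) =
      a%:C%C *: ('i%C *: x) - b%:C%C *: x.
    rewrite !scalerA -scaleNr -scalerDl; congr (_ *: _).
    by simpc.
  rewrite scalerDl -scalerA !FD FN !FZ; simpc.
  by congr (_ +i* _)%C; ring.
have fl a x y : f (a *: x + y) = a * f x + f y by rewrite fD fZ.
exists f; split=> [//|x Zx|x].
- have gRe y : Z y -> F y = complex.Re (g y) by move=> Zy; apply: FG.
  rewrite /f (gRe x) // (gRe ('i%C *: x)); last exact: subspZ.
  rewrite gZ // mulrC ReiNIm opprK.
  by case: (g x).
(* Rotation by a unimodular [w] makes f (w x) real and equal to |f x|, so the bound on the real part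
   suffices. *)
- have [w w1 wf] := unimodular_cabs (f x).
  have := Fp (w *: x); rewrite pZ w1 mul1r; apply: le_trans.
  have : complex.Re (f (w *: x)) = cabs (f x) by rewrite fZ wf.
  by move=> /= ->.
Qed.

(** * Norms, boundedness and completeness *)

Section Norm.
Variables (R : realType) (X : normedModType R[i]).
Implicit Types x y : X.

Lemma normE x : `|x| = (nrm x)%:C%C.
Proof. by rewrite /nrm RRe_real // normr_real. Qed.

Lemma nrm_ge0 x : 0 <= nrm x.
Proof. by rewrite -ler0c -normE. Qed.

Lemma nrmD x y : nrm (x + y) <= nrm x + nrm y.
Proof. by rewrite -lecR -normE rmorphD /= -!normE ler_normD. Qed.

Lemma nrmZ a x : nrm (a *: x) = cabs a * nrm x.
Proof. by apply: complexI; rewrite -normE normrZ normE normcabs rmorphM. Qed.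

Lemma nrmN x : nrm (- x) = nrm x.
Proof. by rewrite /nrm normrN. Qed.

Lemma nrm0 : nrm (0 : X) = 0.
Proof. by rewrite /nrm normr0. Qed.

Lemma nrm_eq0 x : nrm x = 0 -> x = 0.
Proof. by move=> x0; apply/eqP; rewrite -normr_eq0 normE x0. Qed.

Lemma nrmBC x y : nrm (x - y) = nrm (y - x).
Proof. by rewrite -opprB nrmN. Qed.

Lemma nrm_trans y x z : nrm (x - z) <= nrm (x - y) + nrm (y - z).
Proof. by rewrite -[x in nrm (x - z)](subrK y) -addrA nrmD. Qed.

Lemma nrm_leB x y : nrm x <= nrm (x - y) + nrm y.
Proof. by rewrite -{1}[x](subrK y) nrmD. Qed.

Lemma nrmZr (r : R) x : 0 <= r -> nrm (r%:C%C *: x) = r * nrm x.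
Proof. by move=> r0; rewrite nrmZ cabsC ger0_norm. Qed.

Lemma nbhs_nrmP x (P : set X) :
  nbhs x P <-> exists2 e : R, 0 < e & forall y, nrm (x - y) < e -> P y.
Proof.
rewrite nbhs_ballP; split=> -[e e0 sub].
  have ee : e = (complex.Re e)%:C%C by rewrite RRe_real // gtr0_real.
  exists (complex.Re e); first by rewrite -ltcR -ee.
  by move=> y xy; apply: sub; rewrite -ball_normE /= normE ee ltcR.
exists e%:C%C; first by rewrite /= ltcR.
by move=> y; rewrite -ball_normE /= normE ltcR; apply: sub.
Qed.

Lemma closed_nrmP (F : set X) : closed F <->
  forall x, (forall e : R, 0 < e -> exists2 y, F y & nrm (x - y) < e) -> F x.
Proof.
split=> [cF x lim|cF x clx].
  apply: cF => B /nbhs_nrmP [e e0 sub]; have [y Fy xy] := lim _ e0.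
  by exists y; split=> //; apply: sub.
apply: cF => e e0; have [|y [Fy xy]] := clx [set y | nrm (x - y) < e].
  by apply/nbhs_nrmP; exists e.
by exists y.
Qed.

End Norm.

Definition bounded_lin (R : realType) (X Z : normedModType R[i]) (f : X -> Z) :=
  exists2 K : R, 0 <= K & forall x, nrm (f x) <= K * nrm x.

Section BoundedLinear.
Variables (R : realType) (X Z : normedModType R[i]) (f : X -> Z).
Hypothesis fl : lin f.

Lemma continuous_bounded : continuous f -> bounded_lin f.
Proof.
move=> /(_ 0); rewrite /continuous_at (lin0 fl) => fc.
have : nbhs (0 : Z) [set z : Z | nrm z < 1].
  by apply/nbhs_nrmP; exists 1 => // y; rewrite sub0r nrmN.
move/fc => /= /nbhs_nrmP [e e0 small].
exists (2 / e) => [|x]; first by rewrite divr_ge0 // ltW.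
have [x0|x0] := eqVneq (nrm x) 0.
  by rewrite (nrm_eq0 x0) (lin0 fl) !nrm0 mulr0.
have xpos : 0 < nrm x by rewrite lt_neqAle eq_sym x0 nrm_ge0.
pose r := e / 2 / nrm x; have r0 : 0 < r by rewrite !divr_gt0.
have r0' := ltW r0.
have := small (r%:C%C *: x); rewrite sub0r nrmN nrmZr //=.
rewrite /r divfK // ltr_pdivrMr // ltr_pMr // ltr1n => /(_ isT).
rewrite (linZ fl) nrmZr // => /ltW.
rewrite -ler_pdivlMl // mulr1 /r !invf_div => /le_trans; apply.
by rewrite mulrC.
Qed.

Lemma bounded_continuous : bounded_lin f -> continuous f.
Proof.
move=> [K K0 fK] x B /nbhs_nrmP [e e0 sub]; apply/nbhs_nrmP.
have K1 : 0 < K + 1 by rewrite ltr_wpDl.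
exists (e / (K + 1)); first by rewrite divr_gt0.
move=> y xy; apply: sub; rewrite -(linB fl); apply: le_lt_trans (fK _) _.
move: xy; rewrite ltr_pdivlMr // mulrC; apply: le_lt_trans.
by rewrite ler_wpM2r ?nrm_ge0 // lerDl.
Qed.

End BoundedLinear.

Lemma bounded_iter (R : realType) (X : normedModType R[i]) (f : X -> X) n :
  bounded_lin f -> bounded_lin (iter n f).
Proof.
move=> [K K0 fK]; elim: n => [|n [M M0 fM]]; first by exists 1 => // x; rewrite mul1r.
exists (K * M); first exact: mulr_ge0.
by move=> x /=; apply: le_trans (fK _) _; rewrite -mulrA ler_wpM2l.
Qed.

Section Completeness.

(** The limit keeps the error bound [b], so later estimates compare numbers instead of filters. *)
Lemma complete_dominated (K : numFieldType) (Z : completeNormedModType K)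
    (u : nat -> Z) (b : nat -> K) :
  (forall m n, (n <= m)%N -> `|u n - u m| <= b n) ->
  (forall e, 0 < e -> exists n, b n < e) ->
  exists x, forall n, `|u n - x| <= b n.
Proof.
move=> ub b0.
have /cauchy_cvgP /cvg_ex [x xlim] : cauchy (u @ \oo).
  apply: cauchy_exP => e e0; have [n bn] := b0 _ e0.
  exists (u n); exists n => // m /= nm; rewrite -ball_normE /=.
  exact: le_lt_trans (ub _ _ nm) bn.
exists x => n; apply/ler_addgt0Pr => e e0; have /= := xlim (ball x e) (nbhsx_ballx x e e0).
move=> [N _ /(_ (maxn N n) (leq_maxl _ _))]; rewrite /= -ball_normE /= => near.
have -> : u n - x = (u n - u (maxn N n)) + (u (maxn N n) - x) by rewrite addrA subrK.
apply: le_trans (ler_normD _ _) _; apply: lerD; first by apply: ub; rewrite leq_maxr.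
by rewrite distrC ltW.
Qed.

Variable R : realType.

Lemma nrm_complete (X : completeNormedModType R[i]) (u : nat -> X) (b : nat -> R) :
  (forall m n, (n <= m)%N -> nrm (u n - u m) <= b n) ->
  (forall e, 0 < e -> exists n, b n < e) ->
  exists x, forall n, nrm (u n - x) <= b n.
Proof.
move=> ub b0; have [||x xlim] := @complete_dominated _ X u (fun n => (b n)%:C%C).
- by move=> m n nm; rewrite normE lecR; apply: ub.
- move=> e e0; have ee : e = (complex.Re e)%:C%C by rewrite RRe_real // gtr0_real.
  have [|n bn] := b0 (complex.Re e); first by rewrite -ltcR -ee.
  by exists n; rewrite ee ltcR.
by exists x => n; rewrite -lecR -normE.
Qed.

Lemma cabs_complete (u : nat -> R[i]) (b : nat -> R) :
  (forall m n, (n <= m)%N -> cabs (u n - u m) <= b n) ->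
  (forall e, 0 < e -> exists n, b n < e) ->
  exists x, forall n, cabs (u n - x) <= 2 * b n.
Proof.
move=> ub b0.
have [|//|x xlim] := @complete_dominated R R (fun n => complex.Re (u n)) b.
  move=> m n nm; apply: le_trans (ub _ _ nm).
  by apply: le_trans (Re_le_cabs _); case: (u n) (u m) => ? ? [].
have [|//|y ylim] := @complete_dominated R R (fun n => complex.Im (u n)) b.
  move=> m n nm; apply: le_trans (ub _ _ nm).
  by apply: le_trans (Im_le_cabs _); case: (u n) (u m) => ? ? [].
exists (x +i* y)%C => n; apply: le_trans (cabs_le _) _.
by have := lerD (xlim n) (ylim n); case: (u n) => ? ? /=; rewrite mulr_natl mulr2n.
Qed.

Lemma half_pow_small (K e : R) : 0 < e -> exists n, K * 2^-1 ^+ n < e.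
Proof.
move=> e0; have [K0|K0] := leP K 0.
  by exists 0%N; rewrite expr0 mulr1; apply: le_lt_trans e0.
exists (Num.trunc (K / e)).+1; rewrite exprVn ltr_pdivrMr ?exprn_gt0 //.
rewrite -ltr_pdivrMl // mulrC; apply: lt_trans (truncnS_gt _) _.
by rewrite -natrX ltr_nat ltn_expl.
Qed.

(** The bounds telescope to 2 K (2^-n - 2^-m). [N] is abstract because the estimate serves both the
    norm of X and the modulus of scalars. *)
Lemma geometric_tail (E : zmodType) (N : E -> R) (u : nat -> E) (K : R) :
  (forall x y, N (x + y) <= N x + N y) -> N 0 = 0 -> 0 <= K ->
  (forall n, N (u n - u n.+1) <= K * 2^-1 ^+ n) ->
  forall m n, (n <= m)%N -> N (u n - u m) <= 2 * K * 2^-1 ^+ n.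
Proof.
move=> ND N0 K0 uK m n /subnKC <-; move: (m - n)%N => {m} k.
suff : N (u n - u (n + k)%N) <= 2 * K * (2^-1 ^+ n - 2^-1 ^+ (n + k)).
  move/le_trans; apply; rewrite ler_wpM2l ?mulr_ge0 // gerBl.
  by rewrite exprn_ge0 // invr_ge0.
elim: k => [|k IHk]; first by rewrite addn0 !subrr N0 mulr0.
rewrite -(subrK (u (n + k)%N) (u n)) -addrA.
apply: le_trans (ND _ _) _; apply: le_trans (lerD IHk (_ : _ <= K * 2^-1 ^+ (n + k))) _.
  by rewrite addnS; apply: uK.
by rewrite addnS exprS; lra.
Qed.

End Completeness.

(** * The open mapping theorem for ranges of finite codimension *)

Section OpenMapping.
Variables (R : realType) (X : completeNormedModType R[i]).
Implicit Types (W D : set X) (x y v : X).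

Local Notation h := (2^-1 : R).

Let h0 : 0 < h. Proof. by rewrite invr_gt0. Qed.
Let hX0 n : 0 < h ^+ n. Proof. exact: exprn_gt0. Qed.

(** The weights 2^-(k+1) have total 1: these are the partial sums of an infinite convex
    combination. *)
Definition half_sum (E : lmodType R[i]) (d : nat -> E) (n : nat) : E :=
  \sum_(k < n) (h ^+ k.+1)%:C%C *: d k.

Lemma half_sumS (E : lmodType R[i]) (d : nat -> E) n :
  half_sum d n.+1 = half_sum d n + (h ^+ n.+1)%:C%C *: d n.
Proof. by rewrite /half_sum big_ord_recr. Qed.

Definition abs_convex D : Prop := forall (a b : R[i]) x y,
  D x -> D y -> cabs a + cabs b <= 1 -> D (a *: x + b *: y).

(** Closure under convex series. The image of a closed unit ball has this property, although it may
    fail to be closed, and the property survives adjoining a vector. *)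
Definition half_sum_closed D : Prop := forall (d : nat -> X) x (K : R),
  (forall n, D (d n)) -> (forall n, nrm (x - half_sum d n) <= K * h ^+ n) -> D x.

(* [D] plays the role of the image of a closed unit ball under a bounded operator
   with range [W]. *)
Definition range_disc W D : Prop :=
  [/\ subsp W, D `<=` W, abs_convex D, half_sum_closed D &
      forall x, W x -> exists2 r : R, 0 < r & D (r%:C%C *: x)].

Lemma abs_convexZ D a x : abs_convex D -> D x -> cabs a <= 1 -> D (a *: x).
Proof.
by move=> cD Dx a1; have := cD a 0 _ _ Dx Dx; rewrite cabs0 scale0r !addr0; apply.
Qed.

Lemma nrm_half_sum (E : lmodType R[i]) (N : E -> R) (d : nat -> E) :
  (forall x y : E, N (x + y) <= N x + N y) -> N 0 = 0 ->
  (forall (r : R) (x : E), 0 <= r -> N (r%:C%C *: x) = r * N x) ->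
  (forall n, N (d n) <= 1) -> forall n, N (half_sum d n) <= 1 - h ^+ n.
Proof.
move=> ND N0 NZ d1; elim=> [|n IHn].
  by rewrite /half_sum big_ord0 N0 expr0 subrr.
rewrite half_sumS; apply: le_trans (ND _ _) _; rewrite NZ; last exact: ltW.
apply: le_trans (lerD IHn (_ : _ <= h ^+ n.+1)) _.
  by rewrite -[leRHS]mulr1 ler_wpM2l // ltW.
by rewrite exprS; lra.
Qed.

Lemma nrm_half_sumB (E : lmodType R[i]) (N : E -> R) (d : nat -> E) :
  (forall x : E, N (- x) = N x) ->
  (forall (r : R) (x : E), 0 <= r -> N (r%:C%C *: x) = r * N x) ->
  (forall n, N (d n) <= 1) ->
  forall n, N (half_sum d n - half_sum d n.+1) <= h * h ^+ n.
Proof.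
move=> NN NZ d1 n; rewrite half_sumS opprD addrA subrr add0r NN NZ; last exact: ltW.
by rewrite -exprS -[leRHS]mulr1 ler_wpM2l // ltW.
Qed.

Lemma half_sum_cabs (c : nat -> R[i]) : (forall n, cabs (c n) <= 1) ->
  exists2 z, cabs z <= 1 &
    forall n, cabs (z - @half_sum R[i] c n) <= 2 * h ^+ n.
Proof.
move=> c1.
have cZ (r : R) (x : R[i]) : 0 <= r -> cabs (r%:C%C *: x) = r * cabs x.
  by move=> r0; rewrite [_ *: _]/(_ * _) cabsM cabsC ger0_norm.
have tail := geometric_tail (@cabsD R) (cabs0 R) (ltW h0)
  (nrm_half_sumB (@cabsN R) cZ c1).
have [e e0|z zlim] := cabs_complete tail.
  by have [n] := half_pow_small (2 * h) e0; exists n.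
have zlim' n : cabs (z - @half_sum R[i] c n) <= 2 * h ^+ n.
  by rewrite -opprB cabsN; apply: le_trans (zlim n) _; rewrite divff // mul1r.
exists z => //; apply/ler_addgt0Pr => e e0.
have [n en] := half_pow_small 2 e0.
have := nrm_half_sum (@cabsD R) (cabs0 R) cZ c1 n.
have := cabsD (z - @half_sum R[i] c n) (@half_sum R[i] c n); rewrite subrK.
by have := zlim' n; have := hX0 n; lra.
Qed.

Lemma half_sum_nrm (w : nat -> X) : (forall n, nrm (w n) <= 1) ->
  exists2 z, nrm z <= 1 & forall n, nrm (z - half_sum w n) <= 2 * h ^+ n.
Proof.
move=> w1; have tail := geometric_tail (@nrmD R X) (nrm0 X) (ltW h0)
  (nrm_half_sumB (@nrmN R X) (@nrmZr R X) w1).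
have [e e0|z zlim] := nrm_complete tail.
  by have [n] := half_pow_small (2 * h) e0; exists n.
have zlim' n : nrm (z - half_sum w n) <= 2 * h ^+ n.
  rewrite nrmBC; apply: le_trans (zlim n) _; rewrite divff // mul1r.
  by have := hX0 n; lra.
exists z => //; apply/ler_addgt0Pr => e e0.
have [n en] := half_pow_small 2 e0.
have := nrm_half_sum (@nrmD R X) (nrm0 X) (@nrmZr R X) w1 n.
by have := nrm_leB z (half_sum w n); have := zlim' n; have := hX0 n; lra.
Qed.

(** Baire's argument by hand: if no multiple of [D] were dense in a ball, balls avoiding these
    multiples one after the other would shrink to a point, which by [absD] lies in one of the
    multiples. *)
Lemma range_disc_somewhere_dense D : range_disc setT D ->
  exists n : nat, exists x0, exists2 r : R, 0 < r & forall x, nrm (x - x0) < r ->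
    forall e : R, 0 < e -> exists2 d, D d & nrm (x - n.+1%:R *: d) < e.
Proof.
move=> [_ _ cD _ absD]; apply: contrapT => nodense.
have step (n : nat) (s : X * R) : exists t : X * R, 0 < s.2 ->
    [/\ 0 < t.2, t.2 <= h * s.2, nrm (s.1 - t.1) + t.2 <= s.2 &
        forall d, D d -> t.2 < nrm (t.1 - n.+1%:R *: d)].
  case: s => x0 r; have [r0|] := pselect (0 < r); last by exists (0, 0).
  apply: contrapT => nostep; apply: nodense; exists n; exists x0; exists r => //.
  move=> x xr e e0; apply: contrapT => far; apply: nostep.
  have far' d : D d -> e <= nrm (x - n.+1%:R *: d).
    by move=> Dd; rewrite leNgt; apply/negP => ?; apply: far; exists d.
  (* The first bound keeps the new ball away from the multiple of [D]; the second keeps it inside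
     the old ball with at most half the radius. *)
  exists (x, Num.min (h * e) (h * (r - nrm (x - x0)))) => _ /=.
  have a0 : 0 < h * e by rewrite mulr_gt0.
  have b0 : 0 < h * (r - nrm (x - x0)) by rewrite mulr_gt0 // subr_gt0.
  have xx0 := nrm_ge0 (x - x0).
  split.
  - by rewrite lt_min a0 b0.
  - by rewrite ge_min; apply/orP; right; rewrite ler_pM2l // gerBl.
  - rewrite nrmBC; apply: (@le_trans _ _ (nrm (x - x0) + h * (r - nrm (x - x0)))).
      by rewrite lerD2l ge_min lexx orbT.
    by lra.
  - move=> d /far'; apply: lt_le_trans; rewrite gt_min; apply/orP; left; lra.
have [nxt nxtP] := choice (fun ns : nat * (X * R) => step ns.1 ns.2).
pose st := fix st n := if n is k.+1 then nxt (k, st k) else (0 : X, 1 : R).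
have st0 n : 0 < (st n).2 by elim: n => //= n IHn; case: (nxtP (n, st n) IHn).
have stP n := nxtP (n, st n) (st0 n).
have sth n : (st n).2 <= h ^+ n.
  elim: n => [|n IHn]; first by rewrite expr0.
  by case: (stP n) => _ /le_trans + _ _; apply; rewrite exprS ler_pM2l.
have nested m n : (n <= m)%N -> nrm ((st n).1 - (st m).1) + (st m).2 <= (st n).2.
  move/subnKC <-; elim: (m - n)%N => [|k IHk].
    by rewrite addn0 subrr nrm0 add0r.
  rewrite addnS; case: (stP (n + k)%N) => _ _ le1 _ /=.
  by have /= := nrm_trans (st (n + k)%N).1 (st n).1 (st (n + k).+1).1; lra.
have [m n nm|e e0|z zlim] := @nrm_complete R X (fun n => (st n).1) (fun n => (st n).2).
- by have := nested _ _ nm; have := st0 m; lra.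
- have [n] := half_pow_small 1 e0; rewrite mul1r => hn; exists n.
  exact: le_lt_trans (sth n) hn.
have [r r0 Dr] := absD z I.
have [n nr] : exists n : nat, r^-1 <= n.+1%:R.
  by exists (Num.trunc r^-1); apply: ltW; apply: truncnS_gt.
have [_ _ _ /(_ (n.+1%:R^-1 *: z))] := stP n.
have -> : n.+1%:R *: (n.+1%:R^-1 *: z) = z.
  by rewrite scalerA divff ?scale1r // pnatr_eq0.
move=> far; have := zlim n.+1; rewrite leNgt => /negP; apply; apply: far.
have -> : (n.+1%:R^-1 : R[i]) = ((n.+1%:R * r)^-1)%:C%C * r%:C%C.
  by rewrite -rmorphM /= invfM divfK ?gt_eqF // fmorphV rmorph_nat.
rewrite -scalerA; apply: abs_convexZ => //.
rewrite cabsC gtr0_norm ?invr_gt0 ?mulr_gt0 ?ltr0n // invf_le1 ?mulr_gt0 ?ltr0n //.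
by rewrite -ler_pdivrMr // mul1r.
Qed.

Lemma range_disc_open D : range_disc setT D ->
  exists2 e : R, 0 < e & forall x, nrm x < e -> D x.
Proof.
move=> rD; have [n [x0 [r r0 dense]]] := range_disc_somewhere_dense rD.
case: rD => _ _ cD sD _; pose N : R := n.+1%:R.
have N0 : 0 < N by rewrite ltr0n.
have NC : (n.+1%:R : R[i]) = N%:C%C by rewrite rmorph_nat.
(* Half the difference of approximants to [x0 + y] and [x0 - y] approximates y, which moves the
   dense ball to the origin. *)
have near x (e : R) : nrm x < r / N -> 0 < e -> exists2 d, D d & nrm (x - d) < e.
  rewrite ltr_pdivlMr // mulrC => xr e0; pose y := N%:C%C *: x.
  have yr : nrm y < r by rewrite nrmZr // ltW.
  have Ne : 0 < N * e by rewrite mulr_gt0.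
  have [|d1 D1 e1] := dense (x0 + y) _ _ Ne; first by rewrite addrAC subrr add0r.
  have [|d2 D2 e2] := dense (x0 - y) _ _ Ne.
    by rewrite addrAC subrr add0r nrmN.
  exists (h%:C%C *: d1 + (- h%:C%C) *: d2).
    by apply: cD; rewrite // cabsN cabsC gtr0_norm ?h0 //; lra.
  rewrite -(ltr_pM2l N0) -nrmZr; last exact: ltW.
  have -> : N%:C%C *: (x - (h%:C%C *: d1 + - h%:C%C *: d2)) =
      h%:C%C *: ((x0 + y - n.+1%:R *: d1) - (x0 - y - n.+1%:R *: d2)).
    have mid (A B : X) : (x0 + y - A) - (x0 - y - B) = (y + y) - (A - B).
      rewrite [x0 + y]addrC [x0 - y]addrC -!addrA opprD opprK; congr (_ + _).
      by rewrite !opprB [x0 + _]addrC !addrA subrK -addrA addrC.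
    rewrite mid NC /y scaleNr -!scalerBr -scalerDr -scalerBr !scalerA.
    rewrite [h%:C%C * _]mulrC -!scalerA; congr (_ *: _).
    rewrite [RHS]scalerBr -mulr2n -[x *+ 2]scaler_nat scalerA fmorphV rmorph_nat.
    by rewrite mulVf ?scale1r.
  rewrite nrmZr; last exact: ltW.
  by have := nrmD (x0 + y - n.+1%:R *: d1) (- (x0 - y - n.+1%:R *: d2));
     rewrite nrmN; lra.
pose del := r / N; have del0 : 0 < del by rewrite divr_gt0.
exists (h * del) => [|x0']; first by rewrite mulr_gt0.
rewrite -ltr_pdivrMl // invrK => xdel.
have ex_pick x : exists d, nrm x < del -> D d /\ nrm (x - d) < h * del.
  have [xd|] := pselect (nrm x < del); last by exists 0.
  by have [|d Dd xd'] := near x (h * del) xd; [rewrite mulr_gt0|exists d].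
have [pick pickP] := choice ex_pick.
(* Doubling brings the residual back to the scale [del]: after k steps the error is 2^-(k+1) times a
   vector of norm below [del], so [x0'] is a convex series in [D]. *)
pose res := fix res k := if k is j.+1 then 2%:R *: (res j - pick (res j))
                         else 2%:R *: x0'.
have two : (2%:R : R[i]) = (2 : R)%:C%C by rewrite rmorph_nat.
have resdel k : nrm (res k) < del.
  elim: k => [|k IHk] /=; rewrite two nrmZr //.
  by have [_] := pickP _ IHk; lra.
apply: (sD (fun k => pick (res k)) _ (h * del)).
  by move=> k; have [] := pickP _ (resdel k).
suff eqn k : x0' - half_sum (fun k => pick (res k)) k = (h ^+ k.+1)%:C%C *: res k.
  move=> k; rewrite eqn nrmZr; last exact: ltW.
  by rewrite exprS mulrAC ler_pM2r // ler_pM2l // ltW.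
elim: k => [|k IHk].
  by rewrite /half_sum big_ord0 subr0 expr1 /= scalerA two -rmorphM /= mulVf ?scale1r.
rewrite half_sumS opprD addrA IHk -scalerBr /= scalerA two -rmorphM /=.
by rewrite [_ ^+ k.+2]exprSr divfK.
Qed.

(** The coefficients along [v] are bounded by 1, so their own convex series converges; this is what
    carries [half_sum_closed] over to the larger disc. *)
Lemma range_disc_adjoin W D v : range_disc W D ->
  range_disc [set x | exists a : R[i], W (x - a *: v)]
             [set x | exists2 a : R[i], cabs a <= 1 & D (x - a *: v)].
Proof.
move=> [sW DW cD sD absD]; split.
- split; first by exists 0; rewrite scale0r subr0; apply: subsp0.
  move=> a x y [b Wx] [c Wy]; exists (a * b + c).
  have -> : a *: x + y - (a * b + c) *: v = a *: (x - b *: v) + (y - c *: v).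
    by rewrite scalerBr scalerA scalerDl opprD addrACA.
  exact: sW.2.
- by move=> x [a _ /DW Wx]; exists a.
- move=> a b x y [c c1 Dx] [d d1 Dy] ab; exists (a * c + b * d).
    apply: le_trans (cabsD _ _) (le_trans _ ab); rewrite !cabsM lerD //.
      by rewrite -[leRHS]mulr1 ler_wpM2l // cabs_ge0.
    by rewrite -[leRHS]mulr1 ler_wpM2l // cabs_ge0.
  have -> : a *: x + b *: y - (a * c + b * d) *: v =
      a *: (x - c *: v) + b *: (y - d *: v).
    by rewrite !scalerBr !scalerA scalerDl opprD addrACA.
  exact: cD.
- move=> d x K Dd lim.
  have ex_c n : exists a, cabs a <= 1 /\ D (d n - a *: v).
    by have [a] := Dd n; exists a.
  have [c cP] := choice ex_c.
  have [z z1 zlim] := half_sum_cabs (fun n => (cP n).1).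
  exists z => //; apply: (sD (fun n => d n - c n *: v) _ (K + 2 * nrm v)).
    by move=> n; case: (cP n).
  move=> n; have -> : half_sum (fun n => d n - c n *: v) n =
      half_sum d n - (@half_sum R[i] c n) *: v.
    rewrite /half_sum scaler_suml -sumrB; apply: eq_bigr => k _.
    by rewrite scalerBr scalerA.
  have -> : x - z *: v - (half_sum d n - (@half_sum R[i] c n) *: v) =
      (x - half_sum d n) - (z - @half_sum R[i] c n) *: v.
    rewrite scalerBl !opprB !addrA [LHS]addrAC [RHS]addrAC; congr (_ + _).
    exact: addrAC.
  apply: le_trans (nrmD _ _) _; rewrite nrmN nrmZ mulrDl.
  apply: lerD; first exact: lim.
  by rewrite mulrAC ler_wpM2r // nrm_ge0.
- move=> x [a Wx]; have [r r0 Dr] := absD _ Wx.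
  pose t := Num.min r (cabs a + 1)^-1.
  have a0 := cabs_ge0 a; have a1 : 0 < cabs a + 1 by lra.
  have t0 : 0 < t by rewrite lt_min r0 invr_gt0.
  exists t => //; exists (t%:C%C * a).
    rewrite cabsM cabsC gtr0_norm //.
    apply: (@le_trans _ _ ((cabs a + 1)^-1 * cabs a)).
      by rewrite ler_wpM2r // ge_min lexx orbT.
    by rewrite ler_pdivrMl // mulr1; lra.
  have -> : t%:C%C *: x - (t%:C%C * a) *: v =
      (t / r)%:C%C *: (r%:C%C *: (x - a *: v)).
    by rewrite scalerA -rmorphM /= divfK ?gt_eqF // scalerBr scalerA.
  apply: abs_convexZ => //; rewrite cabsC gtr0_norm ?divr_gt0 //.
  by rewrite ler_pdivrMr // mul1r ge_min lexx.
Qed.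

(** When no vector is missing, [W] is the whole space and [range_disc_open] applies. Otherwise [v]
    is adjoined, and the result comes back to [W] because for [v] outside [W] the coefficient along
    [v] is unique. *)
Lemma range_disc_cofinite W D s : range_disc W D ->
  (forall x, exists2 y, W y & lspan s (x - y)) ->
  closed W /\ exists2 e : R, 0 < e & forall x, W x -> nrm x < e -> D x.
Proof.
elim: s W D => [|v s IHs] W D rD cof.
  have WT : W = setT.
    apply/seteqP; split=> // x _; have [y Wy xy] := cof x.
    by rewrite -(subrK y x) xy add0r.
  have [|e e0 eD] := @range_disc_open D; first by rewrite -WT.
  by split; [rewrite WT; exact: closedT | exists e => // x _; apply: eD].
have [sW DW cD sD absD] := rD.
have [Wv|nWv] := pselect (W v).
  apply: IHs => // x; have [y Wy [a xy]] := cof x; exists (y + a *: v).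
    by apply: subspD => //; apply: subspZ.
  by rewrite opprD addrA.
have [|cW' [e e0 eD]] := IHs _ _ (range_disc_adjoin v rD).
  move=> x; have [y Wy [a xy]] := cof x; exists (y + a *: v).
    by exists a; rewrite addrK.
  by rewrite opprD addrA.
have uniq a : W (a *: v) -> a = 0.
  move=> Wav; apply/eqP; apply: contrapT => /negP a0; apply: nWv.
  by rewrite -[v]scale1r -(mulVf a0) -scalerA; apply: subspZ.
split; last first.
  exists e => // x Wx xe; have [|a _ Da] := eD x _ xe.
    by exists 0; rewrite scale0r subr0.
  have a0 : a = 0.
    by apply: uniq; rewrite -(subKr x (a *: v)); apply: subspB => //; apply: DW.
  by move: Da; rewrite a0 scale0r subr0.
apply/closed_nrmP => x lim.
have [a Wx] : exists a, W (x - a *: v).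
  move/closed_nrmP: cW'; apply=> d /lim [y Wy xy]; exists y => //.
  by exists 0; rewrite scale0r subr0.
suff a0 : a = 0 by move: Wx; rewrite a0 scale0r subr0.
apply: cabs_eq0; apply/eqP; rewrite eq_le cabs_ge0 andbT.
apply/ler_addgt0Pr => t t0; rewrite add0r.
(* If [y] in [W] is within t e of [x], then (x - y)/t lies in the enlarged disc, so its coefficient
   a/t has modulus at most 1 and |a| <= t. *)
have [y Wy xy] := lim (t * e) (mulr_gt0 t0 e0).
have tN0 : (t%:C%C : R[i]) != 0 by rewrite (inj_eq (@complexI R)) gt_eqF.
have [|| b b1 Db] := eD (t^-1%:C%C *: (x - y)).
- exists (t^-1%:C%C * a).
  have -> : t^-1%:C%C *: (x - y) - (t^-1%:C%C * a) *: v =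
      t^-1%:C%C *: (x - a *: v - y) by rewrite -scalerA -scalerBr addrAC.
  by apply: subspZ => //; apply: subspB.
- by rewrite nrmZr ?invr_ge0 1?ltW // ltr_pdivrMl.
have -> : a = t%:C%C * b.
  apply/eqP; rewrite -subr_eq0; apply/eqP; apply: uniq.
  have -> : (a - t%:C%C * b) *: v = t%:C%C *:
      (t^-1%:C%C *: (x - y) - b *: v) + (y - (x - a *: v)).
    rewrite scalerBr !scalerA fmorphV divff // scale1r scalerBl opprB.
    by rewrite addrACA subrK addrCA [x + _]addrC subrK addrC.
  apply: subspD => //; last exact: subspB.
  by apply: subspZ => //; apply: DW.
by rewrite cabsM cabsC gtr0_norm // -[leRHS]mulr1 ler_pM2l.
Qed.

End OpenMapping.

(** * The dual space *)

(** The open mapping theorem in the form used below, with a norm bound on some preimage of each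
    value. The disc is the image of the closed unit ball; its convex series lift to the domain,
    which is complete. *)
Lemma cofinite_range (R : realType) (X : completeNormedModType R[i])
    (B : X -> X) (s : seq X) : lin B -> bounded_lin B ->
  (forall x, exists z, lspan s (x - B z)) ->
  closed (range B) /\ exists2 K : R, 0 <= K & forall y, range B y ->
    exists2 x, B x = y & nrm x <= K * nrm y.
Proof.
move=> Bl [M M0 BM] cof.
pose D := [set y | exists2 x, nrm x <= 1 & B x = y].
have subR : subsp (range B).
  split; first by exists 0 => //; exact: lin0.
  by move=> a _ _ [x _ <-] [y _ <-]; exists (a *: x + y).
have rD : range_disc (range B) D.
  split=> //.
  - by move=> _ [x _ <-]; exists x.
  - move=> a b _ _ [x x1 <-] [y y1 <-] ab; exists (a *: x + b *: y).
      apply: le_trans (nrmD _ _) (le_trans _ ab); rewrite !nrmZ lerD //.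
        by rewrite -[leRHS]mulr1 ler_wpM2l // cabs_ge0.
      by rewrite -[leRHS]mulr1 ler_wpM2l // cabs_ge0.
    by rewrite Bl (linZ Bl).
  - move=> d x K Dd lim.
    have ex_w n : exists w, nrm w <= 1 /\ B w = d n by have [w] := Dd n; exists w.
    have [w wP] := choice ex_w.
    have [z z1 zlim] := half_sum_nrm (fun n => (wP n).1).
    exists z => //; apply/eqP; rewrite eq_sym -subr_eq0; apply/eqP; apply: nrm_eq0.
    apply/eqP; rewrite eq_le nrm_ge0 andbT; apply/ler_addgt0Pr => e e0; rewrite add0r.
    have [n en] := half_pow_small (K + M * 2) e0.
    have Bsum : B (half_sum w n) = half_sum d n.
      elim: n {en} => [|n IHn]; first by rewrite /half_sum !big_ord0 (lin0 Bl).
      by rewrite !half_sumS addrC Bl (wP n).2 IHn addrC.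
    apply: le_trans (nrm_trans (half_sum d n) _ _) _.
    apply: le_trans (ltW en); rewrite mulrDl; apply: lerD; first exact: lim.
    rewrite -Bsum -(linB Bl) -mulrA; apply: le_trans (BM _) _.
    by rewrite ler_wpM2l // nrmBC.
  - move=> _ [x _ <-]; have x1 : 0 < nrm x + 1 by rewrite ltr_wpDl ?nrm_ge0.
    have i0 : 0 <= (nrm x + 1)^-1 by rewrite invr_ge0 ltW.
    exists (nrm x + 1)^-1; first by rewrite invr_gt0.
    exists ((nrm x + 1)^-1%:C%C *: x); last by rewrite (linZ Bl).
    by rewrite nrmZr // ler_pdivrMl // mulr1 lerDl.
have [|cR [e e0 eD]] := range_disc_cofinite (s := s) rD.
  by move=> x; have [z sz] := cof x; exists (B z) => //; exists z.
split=> //; exists (2 / e) => [|y Ry]; first by rewrite divr_ge0 // ltW.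
have [y0|y0] := eqVneq (nrm y) 0.
  by exists 0; rewrite ?(lin0 Bl) ?nrm0 ?y0 ?mulr0 // (nrm_eq0 y0).
have ypos : 0 < nrm y by rewrite lt_neqAle eq_sym y0 nrm_ge0.
pose r := e / 2 / nrm y; have r0 : 0 < r by rewrite !divr_gt0.
have r0' := ltW r0.
have [||x x1 Bx] := eD (r%:C%C *: y).
- exact: subspZ.
- by rewrite nrmZr // /r divfK // ltr_pdivrMr // ltr_pMr // ltr1n.
exists (r^-1%:C%C *: x).
  rewrite (linZ Bl) Bx scalerA -rmorphM /= mulVf ?gt_eqF //; exact: scale1r.
rewrite nrmZr ?invr_ge0 // -[leRHS]mulr1.
have -> : r^-1 = 2 / e * nrm y by rewrite /r !invf_div mulrC.
by rewrite ler_wpM2l // mulr_ge0 ?nrm_ge0 // divr_ge0 // ltW.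
Qed.

Section Dual.
Variables (R : realType) (X : normedModType R[i]).
Implicit Types f g : X -> R[i].

Lemma dualspP f : dualsp f <->
  lin_fun f /\ exists2 K : R, 0 <= K & forall x, cabs (f x) <= K * nrm x.
Proof.
split=> -[fl H]; split=> //.
  exact: (@continuous_bounded _ X (R[i]^o : normedModType R[i]) f fl H).
exact: (@bounded_continuous _ X (R[i]^o : normedModType R[i]) f fl H).
Qed.

Lemma dnorm_le f (K : R) : 0 <= K -> (forall x, cabs (f x) <= K * nrm x) ->
  dnorm f <= K.
Proof.
move=> K0 fK; apply: ge_sup; first by exists (cabs (f 0)); exists 0; rewrite //= nrm0.
move=> _ [x /= x1 <-]; apply: le_trans (fK x) _.
by rewrite -[leRHS]mulr1 ler_wpM2l.
Qed.

Lemma dnorm_ge0 f : dualsp f -> 0 <= dnorm f.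
Proof.
move=> /dualspP[fl [K K0 fK]].
have : cabs (f 0) <= dnorm f.
  apply: ub_le_sup; last by exists 0; rewrite //= nrm0.
  exists K => _ [x /= x1 <-]; apply: le_trans (fK x) _.
  by rewrite -[leRHS]mulr1 ler_wpM2l.
exact: le_trans (cabs_ge0 _).
Qed.

Lemma dnorm_bound f x : dualsp f -> cabs (f x) <= dnorm f * nrm x.
Proof.
move=> fd; have /dualspP[fl [K K0 fK]] := fd.
have fZ a y : f (a *: y) = a * f y by exact: (@linZ _ X R[i]^o f fl).
have [x0|x0] := eqVneq (nrm x) 0.
  by have := fK x; rewrite x0 !mulr0.
have xpos : 0 < nrm x by rewrite lt_neqAle eq_sym x0 nrm_ge0.
have i0 : 0 <= (nrm x)^-1 by rewrite invr_ge0 nrm_ge0.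
rewrite -ler_pdivrMr // mulrC -[(nrm x)^-1]ger0_norm // -cabsC -cabsM -fZ.
apply: ub_le_sup; last by eexists; [|reflexivity]; rewrite /= nrmZr // mulVf.
exists K => _ [y /= y1 <-]; apply: le_trans (fK y) _.
by rewrite -[leRHS]mulr1 ler_wpM2l.
Qed.

Lemma dual0 : dualsp (fun _ : X => 0 : R[i]).
Proof.
apply/dualspP; split=> [a x y|]; first by rewrite mulr0 addr0.
by exists 0 => // x; rewrite cabs0 mul0r.
Qed.

Lemma dual_extension (Z : set X) g (K : R) : 0 <= K -> subsp Z ->
  (forall a x y, Z x -> Z y -> g (a *: x + y) = a * g x + g y) ->
  (forall x, Z x -> cabs (g x) <= K * nrm x) ->
  exists f, [/\ dualsp f, forall x, Z x -> f x = g x &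
    forall x, cabs (f x) <= K * nrm x].
Proof.
move=> K0 sZ gl gK.
have [x y|a x|f [fl fg fK]] := @hahn_banach _ _ (fun x => K * nrm x) Z g _ _ sZ gl gK.
- by rewrite -mulrDr ler_wpM2l // nrmD.
- by rewrite nrmZ mulrCA.
by exists f; split=> //; apply/dualspP; split=> //; exists K.
Qed.

(** On [W] + C x0 the coefficient of [x0] is a functional bounded by 1/e, where e > 0 bounds the
    distance from [x0] to the closed [W] from below; Hahn-Banach extends it. *)
Lemma dual_separation (W : set X) x0 : closed W -> subsp W -> ~ W x0 ->
  exists f, [/\ dualsp f, forall x, W x -> f x = 0 & f x0 != 0].
Proof.
move=> cW sW nW.
have [e e0 far] : exists2 e : R, 0 < e & forall w, W w -> e <= nrm (x0 - w).
  apply: contrapT => no; apply: nW; move/closed_nrmP: cW; apply=> e e0.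
  apply: contrapT => no'; apply: no; exists e => // w Ww.
  by rewrite leNgt; apply/negP => lt; apply: no'; exists w.
pose Z := [set z | exists a : R[i], W (z - a *: x0)].
have ex_g z : exists a : R[i], Z z -> W (z - a *: x0).
  by have [[a Wa]|] := pselect (Z z); [exists a|exists 0].
have [g gP] := choice ex_g.
have uniq a : W (a *: x0) -> a = 0.
  move=> Wav; apply/eqP; apply: contrapT => /negP a0; apply: nW.
  by rewrite -[x0]scale1r -(mulVf a0) -scalerA; apply: subspZ.
have gE z a : W (z - a *: x0) -> g z = a.
  move=> Wa; have Wg : W (z - g z *: x0) by apply: gP; exists a.
  apply/eqP; rewrite -subr_eq0; apply/eqP; apply: uniq.
  have -> : (g z - a) *: x0 = (z - a *: x0) - (z - g z *: x0).
    by rewrite scalerBl opprB [RHS]addrC addrA subrK.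
  exact: subspB.
have comb a x y b c : W (x - b *: x0) -> W (y - c *: x0) ->
    W (a *: x + y - (a * b + c) *: x0).
  move=> Wx Wy.
  have -> : a *: x + y - (a * b + c) *: x0 = a *: (x - b *: x0) + (y - c *: x0).
    by rewrite scalerBr scalerA scalerDl opprD addrACA.
  exact: sW.2.
have sZ : subsp Z.
  split; first by exists 0; rewrite scale0r subr0; apply: subsp0.
  by move=> a x y [b Wx] [c Wy]; exists (a * b + c); apply: comb.
have [|||f [fd fg _]] := @dual_extension Z g e^-1 _ sZ.
- by rewrite invr_ge0 ltW.
- by move=> a x y Zx Zy; apply: gE; apply: comb; apply: gP.
- move=> z Zz; rewrite mulrC ler_pdivlMr //.
  have [->|g0] := eqVneq (g z) 0; first by rewrite cabs0 mul0r nrm_ge0.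
  have -> : nrm z = cabs (g z) * nrm (x0 - (- (g z)^-1) *: (z - g z *: x0)).
    by rewrite -nrmZ scaleNr opprK scalerDr scalerA divff // scale1r addrC subrK.
  by rewrite ler_wpM2l ?cabs_ge0 //; apply: far; apply: subspZ => //; apply: gP.
exists f; split=> //.
  move=> x Wx; have Wx' : W (x - 0 *: x0) by rewrite scale0r subr0.
  by rewrite fg ?(gE _ _ Wx') //; exists 0.
have Wx' : W (x0 - 1 *: x0) by rewrite scale1r subrr; apply: subsp0.
by rewrite fg ?(gE _ _ Wx') ?oner_eq0 //; exists 1.
Qed.

End Dual.

(** * The operator on the direct sum *)

Section DirectSum.
Variables (R : realType) (X : completeNormedModType R[i]) (T : X -> X) (l : R[i]).
Hypotheses (Tlin : lin_op T) (Tcont : continuous T).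

Local Notation A := (shiftop T l).
Local Notation S := (sumop T l).
(** With target [R[i]^o] the pairs form an [lmodType] whose operations agree with [Yadd] and
    [Yscale], so the lemmas on spans apply; membership of the second component in the dual stays in
    the predicate [Y]. *)
Local Notation YT := ((X * (X -> R[i]^o))%type : lmodType R[i]).

Lemma spanX_lspan (s : seq X) : spanX s = lspan s.
Proof.
elim: s => [|v s IHs] /=; apply/seteqP; split=> x.
- by case=> [[|? ?]] [] // _ ->; rewrite /lincombX /= big_nil.
- by move=> ->; exists [::]; rewrite /lincombX /= big_nil.
- case=> [[|a cs]] [] //= [sz] ->; exists a; rewrite -IHs; exists cs; split=> //.
  by rewrite /lincombX /= big_cons /= addrC addKr.
- case=> a; rewrite -IHs => -[cs [sz xE]]; exists (a :: cs); rewrite /= sz; split=> //.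
  by rewrite /lincombX /= big_cons -/(lincombX cs s) -xE /= addrC subrK.
Qed.

Lemma spanY_lspan (s : seq (X * (X -> R[i]))) : spanY s = @lspan _ YT s.
Proof.
elim: s => [|v s IHs] /=; apply/seteqP; split=> x.
- by case=> [[|? ?]] [] // _ ->.
- by move=> ->; exists [::].
- case=> [[|a cs]] [] //= [sz] ->; exists a; rewrite -IHs; exists cs; split=> //.
  by rewrite addrC; exact: (@addKr YT (a *: (v : YT)) (lincombY cs s)).
- case=> a; rewrite -IHs => -[cs [sz xE]]; exists (a :: cs); rewrite /= sz; split=> //.
  rewrite /lincombY /= -/(lincombY cs s) -xE.
  by rewrite -[LHS](@subrK YT (a *: (v : YT))) addrC.
Qed.

Lemma shiftop_lin : lin A.
Proof.
move=> a x y; rewrite /shiftop Tlin !scalerDr opprD addrACA; congr (_ + _).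
by rewrite scalerN !scalerA mulrC.
Qed.

Lemma shiftop_bounded : bounded_lin A.
Proof.
have [K K0 TK] := continuous_bounded Tlin Tcont.
exists (K + cabs l) => [|x]; first by rewrite addr_ge0 ?cabs_ge0.
apply: le_trans (nrmD _ _) _; rewrite nrmN nrmZ mulrDl; apply: lerD => //.
Qed.

Lemma iter_lin n : lin (iter n A). Proof. exact: lin_iter shiftop_lin. Qed.

Lemma iter_bounded n : bounded_lin (iter n A).
Proof. exact: bounded_iter shiftop_bounded. Qed.

Lemma dual_comp (f : X -> R[i]) (B : X -> X) : lin B -> bounded_lin B ->
  dualsp f -> dualsp (fun u => f (B u)).
Proof.
move=> Bl [K K0 BK] fd; have /dualspP[fl _] := fd; apply/dualspP; split.
  by move=> a x y; rewrite Bl fl.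
exists (dnorm f * K); first by rewrite mulr_ge0 ?dnorm_ge0.
move=> x; apply: le_trans (dnorm_bound _ fd) _.
by rewrite -mulrA ler_wpM2l ?dnorm_ge0.
Qed.

Lemma dnorm_comp (f : X -> R[i]) (B : X -> X) (K : R) : 0 <= K ->
  (forall x, nrm (B x) <= K * nrm x) -> dualsp f ->
  dnorm (fun u => f (B u)) <= K * dnorm f.
Proof.
move=> K0 BK fd; apply: dnorm_le => [|x]; first by rewrite mulr_ge0 ?dnorm_ge0.
apply: le_trans (dnorm_bound _ fd) _.
by rewrite [K * _]mulrC -mulrA ler_wpM2l ?dnorm_ge0.
Qed.

Lemma dual_iter n (f : X -> R[i]) : dualsp f -> dualsp (fun u => f (iter n A u)).
Proof. exact: dual_comp (iter_lin n) (iter_bounded n). Qed.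

Lemma sumop_lin : @lin _ YT YT S.
Proof.
move=> a x y; congr (_, _).
  exact: (shiftop_lin a x.1 y.1).
apply/funext => u; rewrite /sumop /= !fctE /= mulrDr opprD addrACA; congr (_ + _).
by rewrite [a *: _]/(a * _) scalerBr /GRing.scale /= mulrCA.
Qed.

(** Linearity turns f (T u) - l f u into f (A u): on the second component [S] is composition with
    [A]. *)
Lemma sumop_iter n y : lin_fun y.2 ->
  iter n S y = (iter n A y.1, fun u => y.2 (iter n A u)).
Proof.
move=> fl; elim: n => [|n IHn]; first by case: y fl.
have fl' := @linB _ X R[i]^o y.2 fl; have flZ := @linZ _ X R[i]^o y.2 fl.
rewrite iterS IHn /sumop /=; congr (_, _); apply/funext => u.
rewrite -iterS iterSr /shiftop -/(shiftop T l) (linB (iter_lin n)) fl'.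
by rewrite (linZ (iter_lin n)) flZ.
Qed.

Lemma Y_lin (y : X * (X -> R[i])) : Y y -> lin_fun y.2. Proof. by case. Qed.

Lemma iter_sumop_Y n y : Y y -> Y (iter n S y).
Proof. by move=> Yy; rewrite (sumop_iter n (Y_lin Yy)); apply: dual_iter. Qed.

Lemma Y_subsp : @subsp _ YT (@Y R X).
Proof.
split; first exact: dual0.
move=> a x y /dualspP[xl [K K0 xK]] /dualspP[yl [M M0 yM]].
have ev w : (a *: (x : YT) + (y : YT)).2 w = a * x.2 w + y.2 w by [].
apply/dualspP; split=> [b u v|].
  by rewrite !ev xl yl; ring.
exists (cabs a * K + M); first by rewrite addr_ge0 // mulr_ge0 ?cabs_ge0.
move=> u; rewrite ev mulrDl -mulrA; apply: le_trans (cabsD _ _) _.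
by apply: lerD => //; rewrite cabsM ler_wpM2l ?cabs_ge0.
Qed.

Lemma Ynorm_ge0 (y : X * (X -> R[i])) : Y y -> 0 <= Ynorm y.
Proof. by move=> Yy; rewrite addr_ge0 ?nrm_ge0 ?dnorm_ge0. Qed.

Lemma kerYP n x f : kerY (iter n S) (x, f) <->
  [/\ dualsp f, iter n A x = 0 & forall u, f (iter n A u) = 0].
Proof.
split=> [[fd]|[fd Ax fA]].
  rewrite sumop_iter; last exact: (Y_lin fd).
  by move=> [Ax fA]; split=> // u; rewrite (congr1 (@^~ u) fA).
split=> //; rewrite sumop_iter; last by case: fd.
by congr (_, _) => //; apply/funext.
Qed.

Lemma kerY_subsp n : @subsp _ YT (kerY (iter n S)).
Proof.
have Sl := lin_iter n sumop_lin.
split; first by split; [exact: Y_subsp.1 | exact: (lin0 Sl)].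
move=> a x y [Yx Sx] [Yy Sy]; split; first exact: Y_subsp.2.
by rewrite (Sl a x y) Sx Sy; rewrite [LHS](_ : _ = (a *: 0 + 0 : YT)) // scaler0 addr0.
Qed.

Lemma kerY_mono m n : (m <= n)%N -> kerY (iter m S) `<=` kerY (iter n S).
Proof.
move/subnK <- => y [Yy Sy]; split=> //; rewrite iterD Sy.
exact: (lin0 (lin_iter _ sumop_lin)).
Qed.

Lemma kerY_H0 n : kerY (iter n S) `<=` H0 S.
Proof.
move=> y kn; split; first by case: kn.
(* The index must be positive: at 0 the exponent is 0, and 0 to the power 0 is 1. *)
apply: cvg_near_cst; exists n.+1 => // m /= nm.
have [_ ->] := kerY_mono (ltnW nm) kn.
rewrite /Ynorm /= nrm0 add0r.
have -> : dnorm (fun _ : X => 0 : R[i]) = 0.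
  apply/eqP; rewrite eq_le dnorm_ge0 ?andbT; last exact: dual0.
  by apply: dnorm_le => // x; rewrite cabs0 mul0r.
by apply: powR0; rewrite invr_eq0 pnatr_eq0 -lt0n (leq_trans _ nm).
Qed.

(** The root condition enters only in this form. Eventually the n-th root is below 1/(2c), which
    leaves a factor 2^-n against the growth c^n. *)
Lemma H0_small y (c e : R) : H0 S y -> 0 < c -> 0 < e ->
  exists2 n : nat, (0 < n)%N & c ^+ n * Ynorm (iter n S y) < e.
Proof.
move=> [Yy lim] c0 e0; pose del := (2 * c)^-1.
have del0 : 0 < del by rewrite invr_gt0 mulr_gt0.
have [N _ near] : \forall n \near \oo, powR (Ynorm (iter n S y)) n%:R^-1 < del.
  exact: (cvgr_lt _ lim _ del0).
have [k ke] := half_pow_small 1 e0; rewrite mul1r in ke.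
pose n := (maxn N k).+1; exists n => //.
have nN : (N <= n)%N by rewrite leqW // leq_maxl.
have : powR (Ynorm (iter n S y)) n%:R^-1 < del := near n nN; set b := Ynorm _ => bdel.
have b0 : 0 <= b by apply: Ynorm_ge0; apply: iter_sumop_Y.
have bE : b = (b `^ n%:R^-1) ^+ n.
  by rewrite -powR_mulrn ?powR_ge0 // -powRrM mulVf ?powRr1 // pnatr_eq0.
have bd : b <= del ^+ n by rewrite bE lerXn2r ?nnegrE ?powR_ge0 1?ltW // ltW.
apply: (@le_lt_trans _ _ (2^-1 ^+ n)).
  have -> : (2^-1 : R) ^+ n = c ^+ n * del ^+ n.
    by rewrite -exprMn /del invfM mulrCA divff ?mulr1 // gt_eqF.
  by rewrite ler_pM2l ?exprn_gt0.
apply: le_lt_trans ke; apply: ler_wiXn2l; rewrite ?invr_ge0 ?invf_le1 ?ler1n //.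
by rewrite leqW // leq_maxr.
Qed.

End DirectSum.

(** * Finite ascent and descent *)

Section FiniteAscentDescent.
Variables (R : realType) (X : completeNormedModType R[i]) (T : X -> X) (l : R[i]).
Hypotheses (Tlin : lin_op T) (Tcont : continuous T).

Local Notation A := (shiftop T l).
Local Notation S := (sumop T l).
Local Notation YT := ((X * (X -> R[i]^o))%type : lmodType R[i]).
Let Al : lin A := shiftop_lin l Tlin.
Let Ab : bounded_lin A := shiftop_bounded l Tlin Tcont.
Let Anl n : lin (iter n A) := iter_lin l Tlin n.

Lemma ker_iter_findim : alpha_fin A ->
  forall n, exists t, kerX (iter n A) `<=` lspan t.
Proof.
move=> [k]; rewrite spanX_lspan => kerA; elim=> [|n [t sub]].
  by exists [::].
apply: (preim_findim Al (t := t) (k := k)).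
- split; first exact: (lin0 (Anl n.+1)).
  by move=> a x y Ax Ay; rewrite /kerX /= -iterS Anl Ax Ay scaler0 addr0.
- by move=> x Ax; apply: sub; rewrite /kerX /= -iterSr.
- by move=> x Ax; rewrite -kerA.
Qed.

Lemma range_iter_cofinite : beta_fin A ->
  forall n, exists s, forall x, exists z, lspan s (x - iter n A z).
Proof.
move=> [k kcof]; elim=> [|n [s cof]].
  by exists [::] => x; exists x; rewrite subrr.
exists (s ++ map (iter n A) k) => x; have [z sz] := cof x.
have [w [y ky zE]] := kcof z; exists w.
have -> : x - iter n.+1 A w = (x - iter n A z) + iter n A y.
  by rewrite zE (linD (Anl n)) iterSr opprD addrA subrK.
by apply: lspan_cat => //; apply: (lspan_map (Anl n)); rewrite -spanX_lspan.
Qed.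

Lemma range_iter_closed : beta_fin A -> forall n,
  closed (rngX (iter n A)) /\ exists2 K : R, 0 <= K & forall y, range (iter n A) y ->
    exists2 x, iter n A x = y & nrm x <= K * nrm y.
Proof.
move=> bA n; have [s cof] := range_iter_cofinite bA n.
exact: cofinite_range (Anl n) (iter_bounded l Tlin Tcont n) cof.
Qed.

Lemma rng_subsp n : subsp (rngX (iter n A)).
Proof.
split; first by exists 0 => //; exact: (lin0 (Anl n)).
by move=> a _ _ [x _ <-] [y _ <-]; exists (a *: x + y) => //; exact: Anl.
Qed.

(** The kernel consists of N(A^n) and the functionals vanishing on R(A^n). The latter are determined
    by their values on the vectors [s] that complete R(A^n) to X. *)
Lemma kerY_findim n : alpha_fin A -> beta_fin A -> findimY (kerY (iter n S)).
Proof.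
move=> aA bA; have [t1 sub1] := ker_iter_findim aA n.
have [s cof] := range_iter_cofinite bA n.
have sk := @kerY_subsp _ _ T l Tlin n.
pose W0 : set YT := kerY (iter n S) `&` [set y | y.1 = 0].
have fstl : @lin _ YT X (fun y => y.1) by [].
have sW0 : subsp W0.
  by apply: subspI => //; split=> // a x y /= -> ->; rewrite scaler0 addr0.
have [|| t0 sub0] := @functionals_findim _ YT W0 X s (fun v y => y.2 v) sW0.
- by [].
- move=> [x f] [kxf /= x0] fs; rewrite x0; congr (_, _); apply/funext => u.
  have /(kerYP l Tlin) [fd _ fA] := kxf.
  have [fl _] := fd; have [z sz] := cof u.
  rewrite -(subrK (iter n A z) u) (@linD _ X R[i]^o f fl) fA addr0.
  suff /(_ _ sz) : lspan s `<=` [set v | f v = 0] by [].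
  apply: lspan_sub fs; split; first exact: (@lin0 _ X R[i]^o f fl).
  by move=> a v w /= fv fw; rewrite fl fv fw mulr0 addr0.
have simg : subsp ((fun y : YT => y.1) @` (kerY (iter n S) : set YT)).
  split; first by exists 0 => //; exact: sk.1.
  by move=> a _ _ [x kx <-] [y ky <-]; exists (a *: x + y) => //; exact: sk.2.
have [|t1' [t1W eqt1]] := sub_lspan simg (t := t1).
  by move=> _ [[x f] /(kerYP l Tlin)[_ Ax _] <-]; apply: sub1.
have ex_lift : exists s1, (forall y, y \in s1 -> kerY (iter n S) y) /\
    forall x, lspan t1' x -> exists2 y : YT, lspan (s1 : seq YT) y & y.1 = x.
  elim: (t1') t1W => [_|v t' IHt sub].
    by exists [::]; split=> // x ->; exists 0.
  have [w kw wv] := sub v (mem_head _ _).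
  have [u ut|s1 [s1k lift]] := IHt; first by apply: sub; rewrite inE ut orbT.
  exists (w :: s1); split=> [y|x [a /lift [y sy yE]]].
    by rewrite inE => /orP[/eqP->|/s1k].
  exists (y + a *: w); first by exists a; rewrite addrK.
  by rewrite [LHS]/(y.1 + a *: w.1) wv yE; exact: subrK.
have [s1 [s1k lift]] := ex_lift.
have [|s' [s'k eqs']] := sub_lspan sk (t := s1 ++ t0).
  move=> y ky; have [|z sz zE] := lift y.1; first by rewrite -eqt1; exists y.
  rewrite -(subrK z y) addrC; apply: lspan_cat => //; apply: sub0; split.
    by apply: subspB => //; apply: (lspan_sub sk s1k).
  by change (y.1 - z.1 = 0); rewrite zE subrr.
by exists s'; split=> [y /s'k[]//|]; rewrite spanY_lspan.
Qed.

Lemma kerY_closed n : closedY (kerY (iter n S)).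
Proof.
move=> u [x f] ku fd lim; apply/(kerYP l Tlin).
have Yu m : Y (Ysub (u m) (x, f)).
  have := subspB (@Y_subsp R X) (ku m).1 fd.
  by [].
have [K K0 AK] := iter_bounded l Tlin Tcont n.
have small (e : R) : 0 < e -> exists m, Ynorm (Ysub (u m) (x, f)) < e.
  by move=> e0; have [N _ near] := cvgr_lt _ lim _ e0; exists N; apply: near => /=.
have K1 : 0 < K + 1 by rewrite ltr_wpDl.
split=> //.
- apply: nrm_eq0; apply/eqP; rewrite eq_le nrm_ge0 andbT; apply/ler_addgt0Pr => e e0.
  rewrite add0r; have [m sm] := small _ (divr_gt0 e0 K1).
  have [g [gx gu]] : exists g, u m = g /\ iter n A g.1 = 0.
    exists (u m); split=> //; have := ku m; case: (u m) => ? ?.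
    by case/(kerYP l Tlin).
  have -> : iter n A x = iter n A (x - (u m).1) by rewrite (linB (Anl n)) gx gu subr0.
  apply: le_trans (AK _) _; rewrite nrmBC.
  move: sm; rewrite ltr_pdivlMr // => /ltW; apply: le_trans.
  rewrite mulrC; apply: ler_pM; rewrite ?nrm_ge0 ?lerDl //.
  exact: dnorm_ge0 (Yu m).
- move=> v; apply: cabs_eq0; apply/eqP; rewrite eq_le cabs_ge0 andbT.
  apply/ler_addgt0Pr => e e0; rewrite add0r.
  have v1 : 0 < nrm (iter n A v) + 1 by rewrite ltr_wpDl ?nrm_ge0.
  have [m sm] := small _ (divr_gt0 e0 v1).
  have uv : (u m).2 (iter n A v) = 0.
    by have := ku m; case: (u m) => ? ?; case/(kerYP l Tlin).
  have -> : cabs (f (iter n A v)) = cabs ((Ysub (u m) (x, f)).2 (iter n A v)).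
    by rewrite /= uv sub0r cabsN.
  apply: le_trans (dnorm_bound _ (Yu m)) _.
  move: sm; rewrite ltr_pdivlMr // => /ltW; apply: le_trans.
  apply: ler_pM; rewrite ?nrm_ge0 ?lerDl //; first by apply: dnorm_ge0; exact: Yu.
  by rewrite /Ynorm lerDr nrm_ge0.
Qed.

Lemma ker_stable p k x : kerX (iter p A) = kerX (iter p.+1 A) ->
  iter (p + k) A x = 0 -> iter p A x = 0.
Proof.
move=> kerE; elim: k => [|k IHk]; first by rewrite addn0.
rewrite addnS -addSn iterD => Ax; apply: IHk.
by have : kerX (iter p.+1 A) (iter k A x) by []; rewrite -kerE /kerX /= -iterD.
Qed.

Lemma rng_stable p k x : rngX (iter p A) = rngX (iter p.+1 A) ->
  exists z, iter p A x = iter (p + k) A z.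
Proof.
move=> rngE; elim: k x => [|k IHk] x; first by exists x; rewrite addn0.
have [z ->] := IHk x; have : rngX (iter p A) (iter p A z) by exists z.
rewrite rngE => -[w _ wE]; exists w.
rewrite [(p + k)%N]addnC [LHS]iterD -wE -iterD; congr (iter _ A w); lia.
Qed.

(** For a suitable [z], A^(p+q) kills x - A^(p+1) z; stability of the kernels at [p] strips the
    surplus A^q. *)
Lemma descent_at_ascent p : kerX (iter p A) = kerX (iter p.+1 A) ->
  descent_fin A -> rngX (iter p A) = rngX (iter p.+1 A).
Proof.
move=> kerE [q rngE]; apply/seteqP; split=> [_ [x _ <-]|_ [x _ <-]]; last first.
  by exists (A x) => //; rewrite -iterSr.
have [z zE] := rng_stable (p + p.+1) (iter p A x) rngE.
have /(ker_stable kerE) : iter (p + q) A (x - iter p.+1 A z) = 0.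
  have -> : iter (p + q) A (x - iter p.+1 A z) =
      iter (q + p) A x - iter ((p + q) + p.+1) A z.
    by rewrite (linB (Anl _)) [iter (_ + p.+1) A z]iterD [(q + p)%N]addnC.
  rewrite iterD zE; apply/eqP; rewrite subr_eq0; apply/eqP.
  congr (iter _ A z); lia.
rewrite (linB (Anl p)) => /eqP; rewrite subr_eq0 => /eqP ->.
by exists (iter p A z) => //; rewrite -!iterD addnC.
Qed.

(* [J] is the Drazin inverse of [A]: it inverts [A] on [R(A^p)] and vanishes on the
   complement [N(A^p)]. *)
Lemma drazin_inverse p : beta_fin A -> kerX (iter p A) = kerX (iter p.+1 A) ->
  rngX (iter p A) = rngX (iter p.+1 A) ->
  exists J : X -> X, [/\ lin J, bounded_lin J, forall x, A (J x) = J (A x),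
    forall x, iter p A (x - A (J x)) = 0 & forall x, iter p A x = 0 -> J x = 0].
Proof.
(* With A^N w = A^p x and J x = A^p w, the exponent N = 2p + 1 gives A^p (A (J x)) = A^p x. *)
move=> bA kerE rngE; pose N := (p + p.+1)%N.
have [_ [K K0 pre]] := range_iter_closed bA N.
have ex_w x : exists w, iter N A w = iter p A x /\ nrm w <= K * nrm (iter p A x).
  have [z zE] := rng_stable p.+1 x rngE.
  by have [|w wE wK] := pre (iter p A x); [exists z|exists w].
have [w wP] := choice ex_w.
have wE x : iter N A (w x) = iter p A x by case: (wP x).
(* The choice of [w] is arbitrary, but A^p w depends only on A^N w; linearity of [J] and its
   commutation with [A] follow. *)
have uniq u v : iter N A u = iter N A v -> iter p A u = iter p A v.
  move=> uv; apply/eqP; rewrite -subr_eq0 -(linB (Anl p)); apply/eqP.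
  by apply: (ker_stable (k := p.+1)) => //; rewrite (linB (Anl _)) uv subrr.
exists (fun x => iter p A (w x)); split.
- move=> a x y; rewrite -Anl; apply: uniq.
  by rewrite Anl !wE Anl.
- have [M M0 AM] := iter_bounded l Tlin Tcont p.
  exists (M * (K * M)); first by rewrite !mulr_ge0.
  move=> x; apply: le_trans (AM _) _; rewrite -!mulrA ler_wpM2l //.
  case: (wP x) => _ /le_trans; apply; rewrite ler_wpM2l //.
- move=> x; rewrite -iterS iterSr; apply: uniq.
  by rewrite -iterSr iterS !wE -iterS iterSr.
- by move=> x; rewrite (linB (Anl p)) -iterS -iterD wE subrr.
- move=> x Ax; rewrite -(lin0 (Anl p)); apply: uniq.
  by rewrite wE Ax (lin0 (Anl N)).
Qed.

(** * Consequences of the Drazin inverse for H0 and K *)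

Section Drazin.
Variables (p : nat) (J : X -> X) (K : R).
Hypotheses (Jl : lin J) (K1 : 0 < K) (JK : forall x, nrm (J x) <= K * nrm x).
Hypotheses (AJ : forall x, A (J x) = J (A x))
  (ApJ : forall x, iter p A (x - A (J x)) = 0)
  (J0 : forall x, iter p A x = 0 -> J x = 0).

Let JAJ x : J (A (J x)) = J x.
Proof.
by have := J0 (ApJ x); rewrite (linB Jl) => /eqP; rewrite subr_eq0 => /eqP <-.
Qed.

Let iterJ_bound n x : nrm (iter n J x) <= K ^+ n * nrm x.
Proof.
elim: n => [|n IHn]; first by rewrite expr0 mul1r.
by rewrite iterS; apply: le_trans (JK _) _; rewrite exprS -mulrA ler_pM2l.
Qed.

Let AiterJ n x : A (iter n J x) = iter n J (A x).
Proof. by elim: n => // n IHn; rewrite !iterS AJ IHn. Qed.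

Let JiterA n x : J (iter n A x) = iter n A (J x).
Proof. by elim: n => // n IHn; rewrite !iterS -AJ IHn. Qed.

Let iterJA n x : iter n.+1 J (iter n.+1 A x) = A (J x).
Proof.
elim: n x => [|n IHn] x; first by rewrite /= AJ.
by rewrite iterS iterSr [iter n.+2 A x]iterSr -iterSr IHn JAJ AJ.
Qed.

Let iterAJ n x : iter n.+1 A (iter n.+1 J x) = A (J x).
Proof.
elim: n x => // n IHn x.
by rewrite iterS [iter n.+2 J x]iterSr IHn AJ JAJ.
Qed.

(** Since A J = J^(n+1) A^(n+1), the norm of A J x is at most K^(n+1) times that of S^(n+1) applied
    to the pair, which becomes arbitrarily small on [H0]. The functional is treated alike through A
    J = A^(n+1) J^(n+1). *)
Lemma drazin_H0 : H0 S = kerY (iter p S).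
Proof.
apply/seteqP; split; last exact: kerY_H0.
move=> [x f] Hxf; have fd : dualsp f by case: Hxf.
have [fl _] := fd.
have AJx : A (J x) = 0.
  apply: nrm_eq0; apply/eqP; rewrite eq_le nrm_ge0 andbT; apply/ler_addgt0Pr => e e0.
  have [[//|n] _] := H0_small Tlin Tcont Hxf K1 e0.
  rewrite add0r (sumop_iter l Tlin) // => /ltW; apply: le_trans; rewrite -(iterJA n).
  apply: le_trans (iterJ_bound _ _) _; rewrite ler_pM2l ?exprn_gt0 //.
  by rewrite /Ynorm lerDl; exact: dnorm_ge0 (dual_iter l Tlin Tcont n.+1 fd).
have fAJ u : f (A (J u)) = 0.
  apply: cabs_eq0; apply/eqP; rewrite eq_le cabs_ge0 andbT; apply/ler_addgt0Pr => e e0.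
  have u1 : 0 < nrm u + 1 by rewrite ltr_wpDl ?nrm_ge0.
  have [[//|n] _] := H0_small Tlin Tcont Hxf K1 (divr_gt0 e0 u1).
  have fn := dual_iter l Tlin Tcont n.+1 fd.
  rewrite add0r (sumop_iter l Tlin) // ltr_pdivlMr // => /ltW; apply: le_trans.
  rewrite -(iterAJ n); apply: le_trans (dnorm_bound (iter n.+1 J u) fn) _.
  rewrite [_ ^+ _ * _]mulrC -mulrA; apply: ler_pM; rewrite ?nrm_ge0 ?dnorm_ge0 //.
    by rewrite /Ynorm lerDr nrm_ge0.
  apply: le_trans (iterJ_bound _ _) _.
  by rewrite ler_pM2l ?exprn_gt0 // lerDl.
apply/(kerYP l Tlin); split=> // [|u].
  by have := ApJ x; rewrite AJx subr0.
have := ApJ u; rewrite (linB (Anl p)) => /eqP; rewrite subr_eq0 => /eqP ->.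
by rewrite -iterSr iterS -JiterA fAJ.
Qed.

Lemma drazin_Kcore : findimY (kerY (iter p S)) -> fincodimY (Kcore S).
Proof.
move=> [s [sY sE]]; exists s; split=> // -[x f] fd; have [fl _] := fd.
have fB := @linB _ X R[i]^o f fl.
have Jb : bounded_lin J by exists K => //; exact: ltW.
have Jnl n : lin (iter n J) by exact: lin_iter.
have Jnb n : bounded_lin (iter n J) by exact: bounded_iter.
have fAJd : dualsp (fun u => f (A (J u))) := dual_comp Jl Jb (dual_comp Al Ab fd).
have AJAJ z : A (J (A (J z))) = A (J z) by rewrite JAJ.
exists (A (J x), fun u => f (A (J u))); last first.
  exists (x - A (J x), fun u => f u - f (A (J u))).
    rewrite -sE; apply/(kerYP l Tlin); split=> // [|u].
      exact: (subspB (@Y_subsp R X) (x := (x, f))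
        (y := (A (J x), fun u => f (A (J u)))) fd fAJd).
    rewrite -fB.
    have -> : iter p A u - A (J (iter p A u)) = iter p A (u - A (J u)).
      by rewrite (linB (Anl p)) JiterA -iterS iterSr.
    by rewrite ApJ (@lin0 _ X R[i]^o f fl).
  rewrite /Yadd /= addrC subrK; congr (_, _); apply/funext => u.
  by rewrite addrC subrK.
split=> //; exists K; split=> //.
(* The backward orbit under [J] and its adjoint: the projected pair is fixed by A J on both
   components, so [S] undoes one application of [J], and [K] bounds the growth. *)
exists (fun n => (iter n J (A (J x)), fun u => f (A (J (iter n J u))))).
split=> [n|]; first exact: (dual_comp (Jnl n) (Jnb n) fAJd).
split=> //; split=> [n|n].
  rewrite /sumop; congr (_, _).
    change (A (iter n.+1 J (A (J x))) = iter n J (A (J x))).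
    by rewrite iterSr AiterJ AJAJ.
  apply/funext => u; pose g v := f (A (J (iter n.+1 J v))).
  have gl : lin_fun g := (dual_comp (Jnl n.+1) (Jnb n.+1) fAJd).1.
  have -> : g (T u) - l * g u = g (A u).
    by rewrite (@linB _ X R[i]^o g gl) (@linZ _ X R[i]^o g gl).
  by rewrite /g -AiterJ iterS AJAJ.
rewrite /Ynorm /= mulrDr; apply: lerD; first exact: iterJ_bound.
apply: (dnorm_comp (f := fun u => f (A (J u))) _ _ fAJd); last exact: iterJ_bound.
by rewrite exprn_ge0 // ltW.
Qed.

End Drazin.
End FiniteAscentDescent.

(** * Converse implications *)

Section Converse.
Variables (R : realType) (X : completeNormedModType R[i]) (T : X -> X) (l : R[i]).
Hypotheses (Tlin : lin_op T) (Tcont : continuous T).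

Local Notation A := (shiftop T l).
Local Notation S := (sumop T l).
Local Notation YT := ((X * (X -> R[i]^o))%type : lmodType R[i]).
Local Notation h := (2^-1 : R).
Let Al : lin A := shiftop_lin l Tlin.
Let Ab : bounded_lin A := shiftop_bounded l Tlin Tcont.
Let Anl n : lin (iter n A) := iter_lin l Tlin n.

(** [kerY] sees N(A^n) through the pairs (x, 0), and the closed R(A^n) through the pairs (0, f) with
    [f] vanishing on it. *)
Lemma findim_H0_ascent_descent : beta_fin A -> findimY (H0 S) ->
  ascent_fin A /\ descent_fin A.
Proof.
move=> bA [s [sY sE]]; rewrite spanY_lspan in sE.
have [||m stab] := @chain_lspan_stable _ YT (fun n => kerY (iter n S)) s _
    (fun n => kerY_subsp l Tlin n).
- by left=> m n mn; apply: kerY_mono.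
- by move=> n; rewrite -sE; apply: kerY_H0.
have kerE : kerY (iter m.+1 S) `<=` kerY (iter m S) by rewrite (stab m.+1 (leqnSn m)).
split; exists m; apply/seteqP; split.
- by move=> x Ax; rewrite /kerX /= Ax (lin0 Al).
- move=> x Ax; have /kerE : kerY (iter m.+1 S) (x, fun _ => 0).
    by apply/(kerYP l Tlin); split=> //; exact: dual0.
  by case/(kerYP l Tlin).
- move=> y [x _ yE]; apply: contrapT => ny.
  have [f [fd fW fy]] := dual_separation (range_iter_closed Tlin Tcont bA m.+1).1
    (rng_subsp l Tlin m.+1) ny.
  have /kerE /(kerYP l Tlin) [_ _ /(_ x) fx] : kerY (iter m.+1 S) (0, f).
    apply/(kerYP l Tlin); split=> // [|u]; first exact: (lin0 (Anl _)).
    by apply: fW; exists u.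
  by move: fy; rewrite -yE fx eqxx.
- by move=> _ [x _ <-]; exists (A x) => //; rewrite -iterSr.
Qed.

(** Backward orbits put K(S) inside every range of S^n. Stable ranges on X give the descent; on the
    dual they write f A^m as g A^(m+1), so every f A^m annihilates N(A^(m+1)). *)
Lemma fincodim_Kcore_ascent_descent : fincodimY (Kcore S) ->
  ascent_fin A /\ descent_fin A.
Proof.
move=> [s [sY sE]]; pose W n : set YT := [set iter n S y | y in @Y R X].
have Snl n : @lin _ YT YT (iter n S) := lin_iter n (sumop_lin l Tlin).
have sY' := @Y_subsp R X.
have [||||| m stab] := @cofinite_chain_stable _ YT W (Kcore S) (@Y R X) s.
- move=> m n mn _ [y Yy <-]; exists (iter (n - m) S y); first exact: iter_sumop_Y.
  by rewrite -iterD subnKC.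
- move=> n; split; first by exists 0; [exact: sY'.1 | exact: (lin0 (Snl n))].
  move=> a _ _ [x Yx <-] [y Yy <-]; exists (a *: (x : YT) + (y : YT)).
    exact: sY'.2.
  exact: (Snl n).
- move=> n y [Yy [c [_ [u [uY [<- [uS _]]]]]]]; exists (u n) => //.
  by elim: n => // n IHn; rewrite iterSr uS.
- by move=> n _ [y Yy <-]; apply: iter_sumop_Y.
- move=> y /sE [k Kk [z]]; rewrite spanY_lspan => sz yE; exists k => //.
  have -> : (y : YT) - (k : YT) = z; last by [].
  by rewrite yE addrC; exact: (@addKr YT k z).
have WE : W m `<=` W m.+1 by rewrite (stab m.+1 (leqnSn m)).
split; exists m; apply/seteqP; split.
- by move=> x Ax; rewrite /kerX /= Ax (lin0 Al).
- move=> x Ax; apply: contrapT => ny.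
  have [||| f [fd _ fy]] := @dual_separation R X [set 0] (iter m A x).
  + apply/closed_nrmP => z lim; apply: nrm_eq0; apply/eqP; rewrite eq_le nrm_ge0 andbT.
    apply/ler_addgt0Pr => e /lim [_ ->]; rewrite subr0 add0r => /ltW; exact.
  + by split=> // a u v -> ->; rewrite scaler0 addr0.
  + exact: ny.
  have fl := fd.1.
  have [|[z g] gd] := WE (iter m S (0, f)); first by exists (0, f).
  rewrite !sumop_iter //=; last exact: gd.1.
  move=> [_ /(congr1 (@^~ x)) /= fg]; move: fy; rewrite -fg -iterS Ax.
  by rewrite (@lin0 _ X R[i]^o g gd.1) eqxx.
- move=> _ [x _ <-].
  have [|[z g] gd] := WE (iter m S (x, fun _ => 0)).
    by exists (x, fun _ => 0) => //; exact: dual0.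
  rewrite !sumop_iter //=; [|exact: (@dual0 R X).1|exact: gd.1].
  by move=> [<- _]; exists z.
- by move=> _ [x _ <-]; exists (A x) => //; rewrite -iterSr.
Qed.

Let small_nrm (Z : normedModType R[i]) (z : Z) (K : R) :
  (forall n, nrm z <= K * h ^+ n) -> z = 0.
Proof.
move=> zK; apply: nrm_eq0; apply/eqP; rewrite eq_le nrm_ge0 andbT.
apply/ler_addgt0Pr => e e0; rewrite add0r; have [n /ltW] := half_pow_small K e0.
exact: le_trans (zK n).
Qed.

Let small_cabs (z : R[i]) (K : R) : (forall n, cabs z <= K * h ^+ n) -> z = 0.
Proof.
move=> zK; apply: cabs_eq0; apply/eqP; rewrite eq_le cabs_ge0 andbT.
apply/ler_addgt0Pr => e e0; rewrite add0r; have [n /ltW] := half_pow_small K e0.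
exact: le_trans (zK n).
Qed.

(** * Eigenvectors built from a geometrically bounded chain *)

Section EigenChain.
Variables (a : nat -> X) (g : nat -> X -> R[i]) (C c : R).
Hypotheses (gd : forall n, dualsp (g n)) (C0 : 0 <= C) (c0 : 0 < c).
Hypotheses (aS : forall n, A (a n.+1) = a n) (a0 : A (a 0%N) = 0).
Hypotheses (gS : forall n u, g n.+1 (A u) = g n u) (g0 : forall u, g 0%N (A u) = 0).
Hypotheses (aC : forall n, nrm (a n) <= C * c ^+ n)
  (gC : forall n u, cabs (g n u) <= C * c ^+ n * nrm u).
Hypothesis H0_closed : closedY (H0 S).

Section Eigenvector.
Variable q : R.
Hypotheses (q0 : 0 < q) (q2 : q <= h).

(** The n-th term of the series has size at most C q^n. While q <= 1/2 gives geometric convergence,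
    a factor C q is kept in the tails so that they vanish with [q]. *)
Let mu : R := q / c.
Let mu0 : 0 < mu. Proof. exact: divr_gt0. Qed.
Let m : R[i] := mu%:C%C.
Let sa n : X := \sum_(k < n.+1) m ^+ k *: a k.
Let sg n (u : X) : R[i] := \sum_(k < n.+1) m ^+ k * g k u.

Let saS n : sa n.+1 = sa n + m ^+ n.+1 *: a n.+1.
Proof. by rewrite /sa big_ord_recr. Qed.

Let sgS n u : sg n.+1 u = sg n u + m ^+ n.+1 * g n.+1 u.
Proof. by rewrite /sg big_ord_recr. Qed.

Let sa0 : sa 0 = a 0%N.
Proof. by rewrite /sa big_ord1 expr0 scale1r. Qed.

Let sg0 u : sg 0 u = g 0%N u.
Proof. by rewrite /sg big_ord1 expr0 mul1r. Qed.

Let cabs_mX n : cabs (m ^+ n) = mu ^+ n.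
Proof. by rewrite cabsX cabsC gtr0_norm. Qed.

Let Cq0 : 0 <= C * q. Proof. by rewrite mulr_ge0 // ltW. Qed.

Let geo n : mu ^+ n.+1 * (C * c ^+ n.+1) <= C * q * h ^+ n.
Proof.
rewrite mulrCA -exprMn /mu divfK ?gt_eqF // exprS mulrA ler_wpM2l //.
by rewrite lerXn2r ?nnegrE ?invr_ge0 // ltW.
Qed.

Let sa_tail k n : (n <= k)%N -> nrm (sa n - sa k) <= 2 * (C * q) * h ^+ n.
Proof.
apply: (geometric_tail (@nrmD R X) (nrm0 X) Cq0) => {k}{}n.
rewrite saS opprD addrA subrr add0r nrmN nrmZ cabs_mX.
by apply: le_trans (geo n); rewrite ler_pM2l ?exprn_gt0.
Qed.

Let sg_tail u k n : (n <= k)%N ->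
  cabs (sg n u - sg k u) <= 2 * (C * q * nrm u) * h ^+ n.
Proof.
have Cqu : 0 <= C * q * nrm u by rewrite mulr_ge0 ?nrm_ge0.
apply: (geometric_tail (u := sg^~ u) (@cabsD R) (cabs0 R) Cqu) => {k}{}n.
rewrite sgS opprD addrA subrr add0r cabsN cabsM cabs_mX.
apply: (@le_trans _ _ (mu ^+ n.+1 * (C * c ^+ n.+1) * nrm u)).
  by rewrite -mulrA ler_pM2l ?exprn_gt0.
by rewrite [leRHS]mulrAC ler_wpM2r ?nrm_ge0.
Qed.

Let small_tail (K e : R) : 0 < e -> exists n, 2 * K * h ^+ n < e.
Proof. exact: half_pow_small. Qed.

Let sg_lin n : lin_fun (sg n).
Proof.
move=> b u v; rewrite /sg mulr_sumr -big_split /=; apply: eq_bigr => k _.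
by rewrite (gd k).1; ring.
Qed.

Let sg_dual n : dualsp (sg n).
Proof.
apply/dualspP; split; first exact: sg_lin.
exists (C + 2 * (C * q)) => [|u]; first by rewrite addr_ge0 // mulr_ge0.
have := sg_tail u (leq0n n); rewrite expr0 mulr1 => t.
have := cabsD (sg n u - sg 0 u) (sg 0 u); rewrite subrK => /le_trans; apply.
rewrite addrC mulrDl; apply: lerD.
  by rewrite sg0; have := gC 0 u; rewrite expr0 mulr1.
by rewrite -cabsN opprB; apply: le_trans t _; rewrite !mulrA.
Qed.

(** Places the partial sums in [H0], so that closedness applies to their limit. *)
Let sum_kerY n : kerY (iter n.+1 S) (sa n, sg n).
Proof.
apply/(kerYP l Tlin); split; first exact: sg_dual.
  have ak k : iter k.+1 A (a k) = 0 by elim: k => // k IHk; rewrite iterSr aS.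
  elim: n => [|n IHn]; first by rewrite sa0 ak.
  by rewrite saS (linD (Anl _)) (linZ (Anl _)) ak scaler0 addr0 iterS IHn (lin0 Al).
move=> u; have gk k v : g k (iter k.+1 A v) = 0.
  by elim: k => [|k IHk]; [exact: g0 | rewrite iterS gS].
elim: n u => [|n IHn] u; first by rewrite sg0 gk.
by rewrite sgS gk mulr0 addr0 iterSr IHn.
Qed.

Let A_sa n : A (sa n.+1) = m *: sa n.
Proof.
elim: n => [|n IHn].
  by rewrite saS (linD Al) (linZ Al) aS sa0 a0 add0r expr1.
by rewrite saS (linD Al) (linZ Al) aS IHn saS scalerDr scalerA -exprS.
Qed.

Let A_sg n u : sg n.+1 (A u) = m * sg n u.
Proof.
elim: n => [|n IHn]; first by rewrite sgS !sg0 g0 gS add0r expr1.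
by rewrite sgS IHn gS sgS mulrDr mulrA -exprS.
Qed.

(** The sum (x, f) of the series lies in [H0] and is an eigenvector for [mu], so mu^-n times the
    norm of S^n (x, f) stays constant and yet gets arbitrarily small. The sum therefore vanishes,
    and u_0 is minus the tail, of order C q. *)
Lemma eigenvector_small :
  nrm (a 0%N) <= 2 * (C * q) /\ forall u, cabs (g 0%N u) <= 4 * (C * q * nrm u).
Proof.
have [x xlim] := nrm_complete sa_tail (@small_tail (C * q)).
have ex_f u : exists z, forall n, cabs (sg n u - z) <= 2 * (2 * (C * q * nrm u) * h ^+ n).
  exact: cabs_complete (@sg_tail u) (@small_tail (C * q * nrm u)).
have [f flim'] := choice ex_f.
have flim u n : cabs (sg n u - f u) <= 4 * (C * q * nrm u) * h ^+ n.
  by apply: le_trans (flim' u n) _; rewrite !mulrA -natrM.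
have [KA KA0 AK] := Ab.
have fl : lin_fun f.
  move=> b u v; apply/eqP; rewrite -subr_eq0; apply/eqP.
  apply: (@small_cabs _ (4 * (C * q * nrm (b *: u + v)) +
    cabs b * (4 * (C * q * nrm u)) + 4 * (C * q * nrm v))) => n.
  have -> : f (b *: u + v) - (b * f u + f v) =
     - (sg n (b *: u + v) - f (b *: u + v)) + b * (sg n u - f u) + (sg n v - f v).
    by rewrite (sg_lin n); ring.
  apply: le_trans (cabsD _ _) _; rewrite mulrDl; apply: lerD => //.
  apply: le_trans (cabsD _ _) _; rewrite mulrDl cabsN; apply: lerD => //.
  by rewrite cabsM -mulrA ler_wpM2l ?cabs_ge0.
have fd : dualsp f.
  apply/dualspP; split=> //; exists (C + 4 * (C * q)) => [|u].
    by rewrite addr_ge0 // mulr_ge0.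
  have := flim u 0%N; rewrite expr0 mulr1 => t.
  have := cabsD (f u - sg 0 u) (sg 0 u); rewrite subrK => /le_trans; apply.
  rewrite addrC mulrDl; apply: lerD.
    by rewrite sg0; have := gC 0 u; rewrite expr0 mulr1.
  by rewrite -cabsN opprB; apply: le_trans t _; rewrite !mulrA.
have Hxf : H0 S (x, f).
  apply: (H0_closed (u := fun n => (sa n, sg n))) => //.
    by move=> n; apply: (kerY_H0 Tlin (sum_kerY n)).
  apply/cvgrPdist_lt => e e0.
  (* The error is 2 C q for the vector and 4 C q for the functional, because [cabs_complete] doubles
     the bound. *)
  have [N Ne] := half_pow_small (6 * (C * q)) e0; exists N => // n /= Nn.
  rewrite sub0r normrN.
  have Yn : Y (Ysub (sa n, sg n) (x, f)).
    exact: (subspB (@Y_subsp R X) (x := (sa n, sg n)) (y := (x, f)) (sg_dual n) fd).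
  rewrite ger0_norm; last exact: Ynorm_ge0.
  apply: le_lt_trans Ne; apply: (@le_trans _ _ (6 * (C * q) * h ^+ n)).
    rewrite (_ : 6 * (C * q) = 2 * (C * q) + 4 * (C * q)); last by ring.
    rewrite mulrDl; apply: lerD; first exact: xlim.
    apply: dnorm_le => [|u]; first by rewrite !mulr_ge0 ?exprn_ge0 ?invr_ge0 // ltW.
    by apply: le_trans (flim u n) _; rewrite !mulrA [_ * h ^+ n * _]mulrAC.
  rewrite ler_wpM2l //; first by rewrite mulr_ge0.
  by apply: ler_wiXn2l; rewrite ?invr_ge0 ?invf_le1 ?ler1n.
have Ax : A x = m *: x.
  apply/eqP; rewrite -subr_eq0; apply/eqP.
  apply: (@small_nrm _ _ (KA * (2 * (C * q)) + mu * (2 * (C * q)))) => n.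
  have -> : A x - m *: x = - A (sa n.+1 - x) + m *: (sa n - x).
    by rewrite (linB Al) A_sa scalerBr opprB addrA subrK.
  apply: le_trans (nrmD _ _) _; rewrite mulrDl nrmN nrmZ cabsC gtr0_norm //.
  apply: lerD; last by rewrite -mulrA ler_pM2l.
  apply: le_trans (AK _) _; rewrite -mulrA ler_wpM2l //.
  apply: le_trans (xlim n.+1) _; rewrite ler_wpM2l //; first by rewrite mulr_ge0.
  by apply: ler_wiXn2l; rewrite ?invr_ge0 ?invf_le1 ?ler1n.
have fA u : f (A u) = m * f u.
  apply/eqP; rewrite -subr_eq0; apply/eqP.
  apply: (@small_cabs _ (4 * (C * q * nrm (A u)) + mu * (4 * (C * q * nrm u)))) => n.
  have -> : f (A u) - m * f u = - (sg n.+1 (A u) - f (A u)) + m * (sg n u - f u).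
    by rewrite A_sg; ring.
  apply: le_trans (cabsD _ _) _; rewrite mulrDl cabsN cabsM cabsC gtr0_norm //.
  apply: lerD; last by rewrite -mulrA ler_pM2l.
  apply: le_trans (flim _ n.+1) _; rewrite ler_wpM2l ?mulr_ge0 ?nrm_ge0 //.
    by rewrite ltW.
  by apply: ler_wiXn2l; rewrite ?invr_ge0 ?invf_le1 ?ler1n.
have Anx n : iter n A x = m ^+ n *: x.
  elim: n => [|n IHn]; first by rewrite expr0 scale1r.
  by rewrite iterS IHn (linZ Al) Ax scalerA exprSr.
have fAn n u : f (iter n A u) = m ^+ n * f u.
  elim: n u => [|n IHn] u; first by rewrite expr0 mul1r.
  by rewrite iterS fA IHn mulrA exprS.
have imu0 : 0 < mu^-1 by rewrite invr_gt0.
have x0 : x = 0.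
  apply: nrm_eq0; apply/eqP; rewrite eq_le nrm_ge0 andbT; apply/ler_addgt0Pr => e e0.
  have [n _] := H0_small Tlin Tcont Hxf imu0 e0.
  rewrite add0r (sumop_iter l Tlin) // => /ltW; apply: le_trans.
  have fnd := dual_iter l Tlin Tcont n fd.
  rewrite /Ynorm /= Anx nrmZ cabs_mX mulrDr mulrA -exprMn mulVf ?gt_eqF //.
  by rewrite expr1n mul1r lerDl mulr_ge0 ?dnorm_ge0 // exprn_ge0 // ltW.
have f0 u : f u = 0.
  apply: cabs_eq0; apply/eqP; rewrite eq_le cabs_ge0 andbT; apply/ler_addgt0Pr => e e0.
  have u1 : 0 < nrm u + 1 by rewrite ltr_wpDl ?nrm_ge0.
  have [n _] := H0_small Tlin Tcont Hxf imu0 (divr_gt0 e0 u1).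
  rewrite add0r (sumop_iter l Tlin) // ltr_pdivlMr // => /ltW; apply: le_trans.
  have fnd := dual_iter l Tlin Tcont n fd.
  have := dnorm_bound u fnd; rewrite /= fAn cabsM cabs_mX => b.
  have -> : cabs (f u) = mu^-1 ^+ n * (mu ^+ n * cabs (f u)).
    by rewrite mulrA -exprMn mulVf ?gt_eqF // expr1n mul1r.
  rewrite -mulrA ler_pM2l ?exprn_gt0 //; apply: le_trans b _.
  by apply: ler_pM; rewrite ?nrm_ge0 ?dnorm_ge0 ?lerDl // /Ynorm lerDr nrm_ge0.
split; first by have := xlim 0%N; rewrite sa0 x0 subr0 expr0 mulr1.
by move=> u; have := flim u 0%N; rewrite sg0 f0 subr0 expr0 mulr1.
Qed.

End Eigenvector.

(* The eigenvectors [sum_n mu^n u_n] of the chain [u_n = (a n, g n)] lie in the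
   closed set [H0], which contains no eigenvector with [mu != 0]; they tend to
   [u_0] as [mu] tends to [0]. *)
Lemma eigen_chain_trivial : a 0%N = 0 /\ forall u, g 0%N u = 0.
Proof.
have hq n : 0 < h * h ^+ n /\ h * h ^+ n <= h.
  have h0 : 0 < h by rewrite invr_gt0.
  split; first by rewrite mulr_gt0 ?exprn_gt0.
  by rewrite -[leRHS]mulr1 ler_pM2l // exprn_ile1 ?invf_le1 ?ler1n // ltW.
split=> [|u].
  apply: (@small_nrm _ _ C) => n; have [q0 q2] := hq n.
  have [+ _] := eigenvector_small q0 q2 => /le_trans; apply.
  by rewrite le_eqVlt; apply/orP; left; apply/eqP; field.
apply: (@small_cabs _ (2 * (C * nrm u))) => n; have [q0 q2] := hq n.
have [_ /(_ u) /le_trans] := eigenvector_small q0 q2; apply.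
by rewrite le_eqVlt; apply/orP; left; apply/eqP; field.
Qed.

End EigenChain.

(** The intersections of N(A) with R(A^n) decrease inside a finite-dimensional space and are
    constant from [m] on. Hence [A] maps [Rinf] onto itself, and infinite ascent supplies a nonzero
    kernel vector in [Rinf] to start the chain. *)
Lemma closed_H0_ascent : fredholm A -> closedY (H0 S) -> ascent_fin A.
Proof.
move=> [_ [[k]]]; rewrite spanX_lspan => kE bA Hc; apply: contrapT => noasc.
pose W n := kerX A `&` rngX (iter n A).
have rng_mono m n : (m <= n)%N -> rngX (iter n A) `<=` rngX (iter m A).
  move=> mn _ [x _ <-]; exists (iter (n - m) A x) => //.
  by rewrite -iterD subnKC.
have skA : subsp (kerX A).
  split; first exact: (lin0 Al).
  by move=> b x y Ax Ay; rewrite /kerX /= Al Ax Ay scaler0 addr0.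
have [||m stab] := @chain_lspan_stable _ X W k _
    (fun n => subspI skA (rng_subsp l Tlin n)).
- by right=> m n mn x [Ax Rx]; split=> //; apply: rng_mono Rx.
- by move=> n x []; rewrite kE.
have [x Ax1 Ax] : exists2 x, iter m.+1 A x = 0 & iter m A x <> 0.
  apply: contrapT => no; apply: noasc; exists m; apply/seteqP; split=> x Ax.
    by rewrite /kerX /= Ax (lin0 Al).
  by apply: contrapT => nAx; apply: no; exists x.
pose Rinf := [set y | forall n, rngX (iter n A) y].
have Winf y : W m y -> Rinf y.
  move=> Wy n; apply: (rng_mono n (maxn m n) (leq_maxr _ _)).
  suff : W (maxn m n) y by case.
  by rewrite stab ?leq_maxl.
have [_ [K K0 pre]] := range_iter_closed Tlin Tcont bA m.+1.
have [M M0 AM] := iter_bounded l Tlin Tcont m.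
pose c := M * K + 1; have c0 : 0 < c by rewrite ltr_wpDl ?mulr_ge0.
have ex_next y : exists z, Rinf y -> [/\ Rinf z, A z = y & nrm z <= c * nrm y].
  have [Ry|] := pselect (Rinf y); last by exists 0.
  (* Going back by A^(m+1) places A^m w in R(A^m). It differs from A^(m+n) z by an element of N(A)
     in R(A^m), which by stability lies in R(A^(m+n)). *)
  have [w wE wK] := pre y (Ry m.+1); exists (iter m A w) => _; split=> //.
    move=> n; have [z _ zE] := Ry (m + n).+1.
    have Rz j : (j <= m + n)%N -> rngX (iter j A) (iter (m + n) A z).
      by move=> jn; apply: (rng_mono _ _ jn); exists z.
    have : W (m + n)%N (iter m A w - iter (m + n) A z).
      rewrite stab ?leq_addr //; split.
        by rewrite /kerX /= (linB Al) -!iterS wE zE subrr.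
      by apply: subspB (rng_subsp l Tlin m) _ _; [exists w | apply: Rz; exact: leq_addr].
    case=> _ /(rng_mono _ _ (leq_addl m n)) Rd.
    rewrite -(subrK (iter (m + n) A z) (iter m A w)).
    by apply: subspD (rng_subsp l Tlin n) Rd _; apply: Rz; exact: leq_addl.
  apply: le_trans (AM _) _; apply: (@le_trans _ _ (M * K * nrm y)).
    by rewrite -mulrA ler_wpM2l.
  by rewrite ler_wpM2r ?nrm_ge0 // lerDl.
have [nx nxP] := choice ex_next.
have R0 : Rinf (iter m A x) by apply: Winf; split=> //; exists x.
have Ra n : Rinf (iter n nx (iter m A x)).
  by elim: n => // n IHn; have [] := nxP _ IHn.
have [||||||||||y0 _] := @eigen_chain_trivial (fun n => iter n nx (iter m A x))
  (fun _ _ => 0) (nrm (iter m A x)) c.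
- by move=> n; exact: dual0.
- exact: nrm_ge0.
- by [].
- by move=> n; have [] := nxP _ (Ra n).
- exact: Ax1.
- by [].
- by [].
- elim=> [|n IHn]; first by rewrite expr0 mulr1.
  have [_ _ /le_trans] := nxP _ (Ra n); apply.
  by rewrite exprS mulrCA ler_pM2l.
- by move=> n u; rewrite cabs0 !mulr_ge0 ?nrm_ge0 // exprn_ge0 // ltW.
- exact: Hc.
exact: Ax y0.
Qed.

(** A functional vanishing on R(A^(p+1)) but not at A^p x starts a chain in the dual. Sending
    A^(p+1) u to k (A^p u) is well defined as the kernels agree, bounded by the preimage estimate,
    and extends by Hahn-Banach; composition with A^p gives the chain for the adjoint of [A]. *)
Lemma closed_H0_descent p : beta_fin A -> kerX (iter p A) = kerX (iter p.+1 A) ->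
  closedY (H0 S) -> descent_fin A.
Proof.
move=> bA kerE Hc; apply: contrapT => nodesc.
have [x nx] : exists x, ~ rngX (iter p.+1 A) (iter p A x).
  apply: contrapT => no; apply: nodesc; exists p; apply/seteqP; split.
    by move=> _ [x _ <-]; apply: contrapT => nx; apply: no; exists x.
  by move=> _ [x _ <-]; exists (A x) => //; rewrite -iterSr.
have [cR [K K0 pre]] := range_iter_closed Tlin Tcont bA p.+1.
have sR := rng_subsp l Tlin p.+1.
have [f [fd fR fx]] := dual_separation cR sR nx.
have [M M0 AM] := iter_bounded l Tlin Tcont p.
pose c := M * K + 1; have c0 : 0 < c by rewrite ltr_wpDl ?mulr_ge0.
have uniq u v : iter p.+1 A u = iter p.+1 A v -> iter p A u = iter p A v.
  move=> uv; apply/eqP; rewrite -subr_eq0 -(linB (Anl p)); apply/eqP.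
  by apply: (ker_stable (k := 1)) => //; rewrite addn1 (linB (Anl _)) uv subrr.
have ex_pr y : exists z, rngX (iter p.+1 A) y ->
    iter p.+1 A z = y /\ nrm z <= K * nrm y.
  have [Ry|] := pselect (rngX (iter p.+1 A) y); last by exists 0.
  by have [z zE zK] := pre y Ry; exists z.
have [pr prP] := choice ex_pr.
have ex_next (k : X -> R[i]) : exists k', dualsp k -> [/\ dualsp k',
    forall u, k' (iter p.+1 A u) = k (iter p A u) & dnorm k' <= c * dnorm k].
  have [kd|] := pselect (dualsp k); last by exists k.
  have kn := dnorm_ge0 kd; have kl := kd.1.
  pose kK := M * K * dnorm k; have kK0 : 0 <= kK by rewrite !mulr_ge0.
  have [||k' [k'd k'E k'K]] := dual_extension (g := fun y => k (iter p A (pr y))) kK0 sR.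
  - move=> b y z Ry Rz; rewrite -kl -Anl; congr (k _); apply: uniq.
    rewrite Anl (prP y Ry).1 (prP z Rz).1.
    by apply: (prP _ _).1; apply: sR.2.
  - move=> y Ry; apply: le_trans (dnorm_bound _ kd) _.
    rewrite /kK [M * K * _]mulrC -mulrA ler_wpM2l //; apply: le_trans (AM _) _.
    by rewrite -mulrA ler_wpM2l //; case: (prP y Ry).
  exists k' => _; split=> // [u|].
    rewrite k'E; last by exists u.
    by congr (k _); apply: uniq; apply: (prP _ _).1; exists u.
  apply: le_trans (dnorm_le kK0 k'K) _.
  by rewrite /kK ler_wpM2r // lerDl.
have [nxt nxtP] := choice ex_next.
have fnd n : dualsp (iter n nxt f).
  by elim: n => [|n IHn]; [exact: fd | case: (nxtP _ IHn)].
have fnK n : dnorm (iter n nxt f) <= dnorm f * c ^+ n.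
  elim: n => [|n IHn]; first by rewrite expr0 mulr1.
  have [_ _ /le_trans] := nxtP _ (fnd n); apply.
  by rewrite exprS mulrCA ler_pM2l.
have [||||||||||_ /(_ x) /= fx0] := @eigen_chain_trivial (fun _ => 0)
  (fun n u => iter n nxt f (iter p A u)) (dnorm f * M) c.
- by move=> n; exact: (dual_iter l Tlin Tcont p (fnd n)).
- by rewrite mulr_ge0 ?dnorm_ge0.
- by [].
- by move=> n; exact: lin0.
- exact: lin0.
- move=> n u; have [_ nE _] := nxtP _ (fnd n).
  by rewrite -[iter p A (A u)]iterSr; exact: nE.
- by move=> u; rewrite /= -iterSr; apply: fR; exists u.
- by move=> n; rewrite nrm0 !mulr_ge0 ?dnorm_ge0 // exprn_ge0 // ltW.
- move=> n u; apply: le_trans (dnorm_bound _ (fnd n)) _.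
  have -> : dnorm f * M * c ^+ n * nrm u = (dnorm f * c ^+ n) * (M * nrm u) by ring.
  exact: ler_pM (dnorm_ge0 (fnd n)) (nrm_ge0 _) (fnK n) (AM u).
- exact: Hc.
by move: fx; rewrite fx0 eqxx.
Qed.

(** From A^q x = A^(2q+1) z the vector x - A^(q+1) z lies in N(A^q), so R(A) and the
    finite-dimensional N(A^q) together span X. *)
Lemma fredholm_of_descent : alpha_fin A -> descent_fin A -> fredholm A.
Proof.
move=> aA [q rngE].
have bA : beta_fin A.
  have [t sub] := ker_iter_findim Tlin aA q; exists t => x.
  have [z zE] := rng_stable q.+1 x rngE; exists (iter q A z).
  exists (x - iter q.+1 A z); last by rewrite -iterS addrC subrK.
  rewrite spanX_lspan; apply: sub; rewrite /kerX /= -iterS (linB (Anl q)) zE iterD.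
  by rewrite subrr.
by split=> //; exact: (range_iter_closed Tlin Tcont bA 1).1.
Qed.

Lemma ascent_finP : ascent_fin A -> exists p, is_ascent A p.
Proof.
move=> asc; pose P n := `[< kerX (iter n A) = kerX (iter n.+1 A) >].
have exP : exists n, P n by have [n nE] := asc; exists n; apply/asboolP.
case: (ex_minnP exP) => p /asboolP pE pmin; exists p; split=> // n np nE.
by have := pmin n; rewrite leqNgt np => /(_ (asboolT nE)).
Qed.

Lemma ascent_descent_H0_Kcore p : fredholm A -> is_ascent A p -> descent_fin A ->
  H0 S = kerY (iter p S) /\ fincodimY (Kcore S).
Proof.
move=> [_ [aA bA]] [kerE _] desc.
have rngE := descent_at_ascent Tlin kerE desc.
have [J [Jl [K K0 JK] AJ ApJ J0]] := drazin_inverse Tlin Tcont bA kerE rngE.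
have K1 : 0 < K + 1 by rewrite ltr_wpDl.
have JK1 x : nrm (J x) <= (K + 1) * nrm x.
  by apply: le_trans (JK x) _; rewrite ler_wpM2r ?nrm_ge0 // lerDl.
split; first exact: (drazin_H0 Tlin Tcont Jl K1 JK1 AJ ApJ J0).
apply: (drazin_Kcore Tlin Tcont Jl K1 JK1 AJ ApJ J0).
exact: kerY_findim.
Qed.

End Converse.

(** * The equivalences *)

Lemma Delta_e_fredholm (R : realType) (X : normedModType R[i]) (T : X -> X) l :
  Delta_e T l -> fredholm (shiftop T l).
Proof. by move=> [_ /contrapT]. Qed.

(** For a bounded operator [Pi0 T] is contained in [Delta_e T] by [fredholm_of_descent]; the reverse
    inclusion is the finiteness of ascent and descent on [Delta_e T]. *)
Lemma Be_of_ascent_descent (R : realType) (X : completeNormedModType R[i])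
    (T : X -> X) : lin_op T -> continuous T ->
  (forall l, Delta_e T l -> ascent_fin (shiftop T l) /\ descent_fin (shiftop T l)) ->
  Be T.
Proof.
move=> Tlin Tcont fin; apply/seteqP; split=> l.
  move=> Dl; have [asc desc] := fin _ Dl; have [_ [aA _]] := Delta_e_fredholm Dl.
  by case: Dl.
move=> [sl [_ [desc aA]]]; split=> //; apply; exact: fredholm_of_descent.
Qed.

Theorem theorem2p15 (R : realType) (X : completeNormedModType R[i])
    (T : X -> X) (Tlin : lin_op T) (Tcont : continuous T)
    (Xinf : ~ findimX [set: X]) :
  [<-> Be T;
       forall l, Delta_e T l -> exists p : nat, is_ascent (shiftop T l) p /\
         H0 (sumop T l) = kerY (iter p (sumop T l));
       forall l, Delta_e T l -> findimY (H0 (sumop T l));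
       forall l, Delta_e T l -> closedY (H0 (sumop T l));
       forall l, Delta_e T l -> fincodimY (Kcore (sumop T l))].
Proof.
have fin l : Be T -> Delta_e T l -> exists2 p, is_ascent (shiftop T l) p &
    H0 (sumop T l) = kerY (iter p (sumop T l)) /\ fincodimY (Kcore (sumop T l)).
  move=> B Dl; have fA := Delta_e_fredholm Dl.
  have [_ [asc [desc _]]] : Pi0 T l by rewrite -B.
  have [p pA] := ascent_finP asc; exists p => //.
  exact: ascent_descent_H0_Kcore.
have findim_Be : (forall l, Delta_e T l -> findimY (H0 (sumop T l))) -> Be T.
  move=> H; apply: Be_of_ascent_descent => // l Dl.
  have [_ [_ bA]] := Delta_e_fredholm Dl.
  exact: findim_H0_ascent_descent (H l Dl).
have closed_Be : (forall l, Delta_e T l -> closedY (H0 (sumop T l))) -> Be T.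
  move=> H; apply: Be_of_ascent_descent => // l Dl.
  have fA := Delta_e_fredholm Dl; have [_ [_ bA]] := fA.
  have asc := closed_H0_ascent Tlin Tcont fA (H l Dl); split=> //.
  by have [p pE] := asc; apply: closed_H0_descent pE (H l Dl).
(* The steps starting from finite dimension and from closedness of H0 pass through [Be T], under
   which H0 is N(S^p) and K(S) has finite codimension. *)
tfae.
- by move=> B l Dl; have [p pA [HE _]] := fin l B Dl; exists p.
- move=> H l Dl; have [p [_ ->]] := H l Dl; have [_ [aA bA]] := Delta_e_fredholm Dl.
  exact: kerY_findim.
- move=> /findim_Be B l Dl; have [p _ [-> _]] := fin l B Dl.
  exact: kerY_closed.
- by move=> /closed_Be B l Dl; have [p _ [_]] := fin l B Dl.
- move=> H; apply: Be_of_ascent_descent => // l Dl.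
  exact: fincodim_Kcore_ascent_descent (H l Dl).
Qed.
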